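(* Let $\mathcal{C}$ be the category of ternary rings, let $R$ and $S$ be ternary rings, and let $p:R\rightarrowtail S$ be a monomorphism in $\mathcal{C}$ (i.e. an injective homomorphism; $R$ is identified with the subalgebra $p(R)$ of $S$). The following conditions are equivalent: (i) $p$ is an effective codescent morphism in $\mathcal{C}$; (ii) $p$ is a codescent morphism in $\mathcal{C}$; (iii) $p$ satisfies the congruence extension property: for any congruence $\theta$ on $R$ there is a congruence $\theta'$ on $S$ such that $\theta'\cap(R\times R)=\theta$; (iv) $p$ satisfies the $0$-ideal extension property: for any $0$-ideal $I$ of $R$ there is a $0$-ideal $I'$ of $S$ such that $I'\cap R=I$; (v) for any $0$-ideal $I$ of $R$ we have $\left(\bigcup_{i\ge 0}Y_i\right)\cap R=I$, where $Y_0=I$ and, for all $i\ge 1$, $$Y_i=Y_{i-1}\cup\{\tau_1(a_1,h_1),\ \tau_2(a_1,a_2,a_3,h_1),\ \tau_3(a_1,a_2,a_3,h_1,h_2,h_3)\ :\ a_1,a_2,a_3\in S,\ h_1,h_2,h_3\in Y_{i-1}\},$$ with $$\tau_1(x,y)=q(1,t(1,x,y),x),$$ $$\tau_2(x_1,x_2,x_3,y)=q\bigl(1,x_3,q(x_1,x_2,t(1,t(x_1,x_2,x_3),y))\bigr),$$ $$\tau_3(x_1,x_2,x_3,y_1,y_2,y_3)=q\bigl(1,t(x_1,x_2,x_3),t(t(1,x_1,y_1),t(1,x_2,y_2),t(1,x_3,y_3))\bigr).$$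
   Context: A ternary ring is an algebra with two ternary operations $t,q$ and two constants $0,1$ satisfying $t(0,x,y)=y$, $t(x,0,y)=y$, $t(1,x,0)=x$, $t(x,1,0)=x$, $q(x,y,t(x,y,z))=z$, $t(x,y,q(x,y,z))=z$. (Equivalently: a set with a ternary operation $t$ and constants $0,1$ satisfying the first four identities and such that for all $a,b,c$ there is a unique $x$ with $t(a,b,x)=c$; then $q(a,b,c)$ is this $x$. The case $0=1$ is allowed.) Homomorphisms preserve all operations; congruences are equivalence relations compatible with all operations. $0$-ideals (in the sense of Gumm and Ursini): a term $\tau(x_1,\dots,x_m,y_1,\dots,y_n)$ in the operations $t,q,0,1$ is an ideal term in $y_1,\dots,y_n$ if the identity $\tau(x_1,\dots,x_m,0,\dots,0)=0$ holds in all ternary rings. A nonempty subset $I$ of a ternary ring $R$ is a $0$-ideal if $\tau(a_1,\dots,a_m,h_1,\dots,h_n)\in I$ for every such ideal term $\tau$, all $a_1,\dots,a_m\in R$ and all $h_1,\dots,h_n\in I$. Codescent: for a category $\mathcal{C}$ with pushouts and a morphism $p:B\to E$, the change-of-cobase functor $p_*:B/\mathcal{C}\to E/\mathcal{C}$ between coslice categories sends $\varphi:B\to C$ to the pushout of $\varphi$ along $p$ (as an object under $E$). It has a right adjoint $p^!:E/\mathcal{C}\to B/\mathcal{C}$, $\psi\mapsto\psi p$. The morphism $p$ is a codescent morphism if $p_*$ is precomonadic (the comparison functor from $B/\mathcal{C}$ to the category of coalgebras of the comonad $p_*p^!$ on $E/\mathcal{C}$ is full and faithful), and an effective codescent morphism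 if $p_*$ is comonadic (this comparison functor is an equivalence). Equivalently, $p$ is an (effective) descent morphism in $\mathcal{C}^{\mathrm{op}}$. *)

(* Defs.v *)
From HB Require Import structures.
From mathcomp Require Import all_boot.
From mathcomp Require Import boolp classical_sets.

Set Implicit Arguments.
Unset Strict Implicit.
Unset Printing Implicit Defensive.

Local Open Scope classical_set_scope.

#[local] Obligation Tactic := idtac.

Record category := Category {
  obj :> Type;
  hom : obj -> obj -> Type;
  idm : forall A, hom A A;
  cmp : forall A B D, hom B D -> hom A B -> hom A D;
  cmpA : forall A B D E (h : hom D E) (g : hom B D) (f : hom A B),
    cmp h (cmp g f) = cmp (cmp h g) f;
  cmp1m : forall A B (f : hom A B), cmp (idm B) f = f;
  cmpm1 : forall A B (f : hom A B), cmp f (idm A) = f }.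

Arguments hom {c} _ _.
Arguments idm {c} A.
Arguments cmp {c A B D} _ _.

Notation "g ∘ f" := (cmp g f) (at level 40, left associativity).

Definition is_mono (C : category) (A B : C) (f : hom A B) : Prop :=
  forall (Z : C) (g h : hom Z A), f ∘ g = f ∘ h -> g = h.

Definition is_iso (C : category) (A B : C) (f : hom A B) : Prop :=
  exists g : hom B A, g ∘ f = idm A /\ f ∘ g = idm B.

Record functor (C D : category) := Functor {
  fobj :> C -> D;
  fmap : forall A B : C, hom A B -> hom (fobj A) (fobj B);
  fmap1 : forall A, fmap (idm A) = idm (fobj A);
  fmapM : forall A B E (g : hom B E) (f : hom A B),
    fmap (g ∘ f) = fmap g ∘ fmap f }.

Arguments fmap {C D} _ {A B} _.

Definition id_functor (C : category) : functor C C :=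
  @Functor C C id (fun _ _ => id) (fun=> erefl) (fun _ _ _ _ _ => erefl).

Program Definition comp_functor (C D E : category)
    (G : functor D E) (F : functor C D) : functor C E :=
  @Functor C E (fun A => G (F A)) (fun _ _ f => fmap G (fmap F f)) _ _.
Next Obligation. by move=> * /=; rewrite !fmap1. Qed.
Next Obligation. by move=> * /=; rewrite !fmapM. Qed.

Definition full (C D : category) (F : functor C D) : Prop :=
  forall (A B : C) (g : hom (F A) (F B)), exists f : hom A B, fmap F f = g.

Definition faithful (C D : category) (F : functor C D) : Prop :=
  forall A B : C, injective (@fmap _ _ F A B).

Record nat_trans (C D : category) (F G : functor C D) := NatTrans {
  component :> forall A : C, hom (F A) (G A);
  naturality : forall (A B : C) (f : hom A B),
    fmap G f ∘ component A = component B ∘ fmap F f }.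

Definition naturally_isomorphic (C D : category) (F G : functor C D) : Prop :=
  exists eta : nat_trans F G, forall A, is_iso (eta A).

Definition is_equivalence (C D : category) (F : functor C D) : Prop :=
  exists G : functor D C,
    naturally_isomorphic (comp_functor G F) (id_functor C) /\
    naturally_isomorphic (comp_functor F G) (id_functor D).

(* F is left adjoint to G *)
Record adjunction (C D : category) (F : functor C D) (G : functor D C) :=
  Adjunction {
    adj_unit : nat_trans (id_functor C) (comp_functor G F);
    adj_counit : nat_trans (comp_functor F G) (id_functor D);
    adj_triangleL : forall A : C, adj_counit (F A) ∘ fmap F (adj_unit A) = idm (F A);
    adj_triangleR : forall X : D, fmap G (adj_counit X) ∘ adj_unit (G X) = idm (G X) }.

Record comonad (D : category) := Comonad {
  cmd_functor :> functor D D;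
  cmd_counit : nat_trans cmd_functor (id_functor D);
  cmd_comult : nat_trans cmd_functor (comp_functor cmd_functor cmd_functor);
  cmd_counitl : forall X : D,
    cmd_counit (cmd_functor X) ∘ cmd_comult X = idm (cmd_functor X);
  cmd_counitr : forall X : D,
    fmap cmd_functor (cmd_counit X) ∘ cmd_comult X = idm (cmd_functor X);
  cmd_coassoc : forall X : D,
    cmd_comult (cmd_functor X) ∘ cmd_comult X =
    fmap cmd_functor (cmd_comult X) ∘ cmd_comult X }.

Section Coalgebras.
Variables (D : category) (W : comonad D).

Record coalgebra := Coalgebra {
  coalg_obj : D;
  coalg_str : hom coalg_obj (W coalg_obj);
  coalg_counit : cmd_counit W coalg_obj ∘ coalg_str = idm coalg_obj;
  coalg_coassoc :
    cmd_comult W coalg_obj ∘ coalg_str = fmap W coalg_str ∘ coalg_str }.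

Record coalgebra_hom (X Y : coalgebra) := CoalgebraHom {
  coalg_mor : hom (coalg_obj X) (coalg_obj Y);
  coalg_morP : coalg_str Y ∘ coalg_mor = fmap W coalg_mor ∘ coalg_str X }.

Lemma coalgebra_hom_eq X Y (f g : coalgebra_hom X Y) :
  coalg_mor f = coalg_mor g -> f = g.
Proof.
by case: f g => [f Hf] [g Hg] /= E; case: _ / E in Hg *; congr CoalgebraHom.
Qed.

Program Definition coalgebra_id X : coalgebra_hom X X :=
  @CoalgebraHom X X (idm _) _.
Next Obligation. by move=> X; rewrite fmap1 cmp1m cmpm1. Qed.

Program Definition coalgebra_cmp X Y Z (g : coalgebra_hom Y Z)
    (f : coalgebra_hom X Y) : coalgebra_hom X Z :=
  @CoalgebraHom X Z (coalg_mor g ∘ coalg_mor f) _.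
Next Obligation.
by move=> X Y Z g f; rewrite cmpA coalg_morP -cmpA coalg_morP cmpA fmapM.
Qed.

Program Definition coalgebra_category : category :=
  @Category coalgebra coalgebra_hom coalgebra_id coalgebra_cmp _ _ _.
Next Obligation. by move=> *; apply: coalgebra_hom_eq; rewrite /= cmpA. Qed.
Next Obligation. by move=> *; apply: coalgebra_hom_eq; rewrite /= cmp1m. Qed.
Next Obligation. by move=> *; apply: coalgebra_hom_eq; rewrite /= cmpm1. Qed.

End Coalgebras.

Section Comparison.
Variables (C D : category) (F : functor C D) (G : functor D C).
Variable adj : adjunction F G.

Program Definition adj_comult :
    nat_trans (comp_functor F G)
              (comp_functor (comp_functor F G) (comp_functor F G)) :=
  @NatTrans _ _ _ _ (fun X : D => fmap F (adj_unit adj (G X))) _.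
Next Obligation.
move=> X Y f /=; rewrite -!fmapM; congr fmap.
exact: (naturality (adj_unit adj) (fmap G f)).
Qed.

(* the comonad F G on D *)
Program Definition adj_comonad : comonad D :=
  @Comonad D (comp_functor F G) (adj_counit adj) adj_comult _ _ _.
Next Obligation. by move=> X /=; rewrite adj_triangleL. Qed.
Next Obligation. by move=> X /=; rewrite -fmapM adj_triangleR fmap1. Qed.
Next Obligation.
move=> X /=; rewrite -!fmapM; congr fmap.
by rewrite (naturality (adj_unit adj) (adj_unit adj (G X))).
Qed.

Program Definition comparison_obj (A : C) : coalgebra adj_comonad :=
  @Coalgebra D adj_comonad (F A) (fmap F (adj_unit adj A)) _ _.
Next Obligation. by move=> A /=; rewrite adj_triangleL. Qed.
Next Obligation.
move=> A /=; rewrite -!fmapM; congr fmap.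
by rewrite (naturality (adj_unit adj) (adj_unit adj A)).
Qed.

Program Definition comparison_mor (A B : C) (f : hom A B) :
    coalgebra_hom (comparison_obj A) (comparison_obj B) :=
  @CoalgebraHom _ _ (comparison_obj A) (comparison_obj B) (fmap F f) _.
Next Obligation.
move=> A B f /=; rewrite -!fmapM; congr fmap.
by rewrite (naturality (adj_unit adj) f).
Qed.

Program Definition comparison : functor C (coalgebra_category adj_comonad) :=
  @Functor C (coalgebra_category adj_comonad) comparison_obj comparison_mor _ _.
Next Obligation. by move=> A; apply: coalgebra_hom_eq; rewrite /= fmap1. Qed.
Next Obligation. by move=> *; apply: coalgebra_hom_eq; rewrite /= fmapM. Qed.

Definition precomonadic : Prop := full comparison /\ faithful comparison.

Definition comonadic : Prop := is_equivalence comparison.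

End Comparison.

Section Coslice.
Variables (C : category) (B : C).

Record coslice_obj := CosliceObj { cs_cod : C; cs_arr : hom B cs_cod }.

Record coslice_hom (X Y : coslice_obj) := CosliceHom {
  cs_mor : hom (cs_cod X) (cs_cod Y);
  cs_morP : cs_mor ∘ cs_arr X = cs_arr Y }.

Lemma coslice_hom_eq X Y (f g : coslice_hom X Y) : cs_mor f = cs_mor g -> f = g.
Proof.
by case: f g => [f Hf] [g Hg] /= E; case: _ / E in Hg *; congr CosliceHom.
Qed.

Definition coslice_id X : coslice_hom X X := @CosliceHom X X _ (cmp1m _).

Program Definition coslice_cmp X Y Z (g : coslice_hom Y Z)
    (f : coslice_hom X Y) : coslice_hom X Z :=
  @CosliceHom X Z (cs_mor g ∘ cs_mor f) _.
Next Obligation. by move=> X Y Z g f; rewrite -cmpA !cs_morP. Qed.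

Program Definition coslice : category :=
  @Category coslice_obj coslice_hom coslice_id coslice_cmp _ _ _.
Next Obligation. by move=> *; apply: coslice_hom_eq; rewrite /= cmpA. Qed.
Next Obligation. by move=> *; apply: coslice_hom_eq; rewrite /= cmp1m. Qed.
Next Obligation. by move=> *; apply: coslice_hom_eq; rewrite /= cmpm1. Qed.

Lemma cs_morM (X Y Z : coslice) (g : hom Y Z) (f : hom X Y) :
  cs_mor (g ∘ f) = cs_mor g ∘ cs_mor f.
Proof. by []. Qed.

End Coslice.

Record pushout (C : category) (A X Y : C) (f : hom A X) (g : hom A Y) := Pushout {
  po_obj : C;
  po_inl : hom X po_obj;
  po_inr : hom Y po_obj;
  po_square : po_inl ∘ f = po_inr ∘ g;
  po_desc : forall (Z : C) (h : hom X Z) (k : hom Y Z),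
    h ∘ f = k ∘ g -> hom po_obj Z;
  po_descl : forall (Z : C) (h : hom X Z) (k : hom Y Z) (e : h ∘ f = k ∘ g),
    po_desc e ∘ po_inl = h;
  po_descr : forall (Z : C) (h : hom X Z) (k : hom Y Z) (e : h ∘ f = k ∘ g),
    po_desc e ∘ po_inr = k;
  po_uniq : forall (Z : C) (u v : hom po_obj Z),
    u ∘ po_inl = v ∘ po_inl -> u ∘ po_inr = v ∘ po_inr -> u = v }.

Definition pushouts (C : category) : Type :=
  forall (A X Y : C) (f : hom A X) (g : hom A Y), pushout f g.

Section ChangeOfCobase.
Variables (C : category) (P : pushouts C) (B E : C) (p : hom B E).

Let po (X : coslice B) := P (cs_arr X) p.

Definition push_obj (X : coslice B) : coslice E := CosliceObj (po_inr (po X)).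

Lemma push_mor_subproof (X Y : coslice B) (f : hom X Y) :
  (po_inl (po Y) ∘ cs_mor f) ∘ cs_arr X = po_inr (po Y) ∘ p.
Proof. by rewrite -cmpA cs_morP po_square. Qed.

Definition push_mor (X Y : coslice B) (f : hom X Y) :
    hom (push_obj X) (push_obj Y) :=
  @CosliceHom _ _ (push_obj X) (push_obj Y)
    (po_desc (po X) (push_mor_subproof f)) (po_descr _ _).

Lemma push_morl (X Y : coslice B) (f : hom X Y) :
  cs_mor (push_mor f) ∘ po_inl (po X) = po_inl (po Y) ∘ cs_mor f.
Proof. exact: po_descl. Qed.

Lemma push_morr (X Y : coslice B) (f : hom X Y) :
  cs_mor (push_mor f) ∘ po_inr (po X) = po_inr (po Y).
Proof. exact: po_descr. Qed.

Lemma push_mor1 (X : coslice B) : push_mor (idm X) = idm (push_obj X).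
Proof.
apply: coslice_hom_eq; apply: po_uniq.
  by rewrite push_morl /= cmp1m cmpm1.
by rewrite push_morr /= cmp1m.
Qed.

Lemma push_morM (X Y Z : coslice B) (g : hom Y Z) (f : hom X Y) :
  push_mor (g ∘ f) = push_mor g ∘ push_mor f.
Proof.
apply: coslice_hom_eq; apply: po_uniq.
  by rewrite push_morl !cs_morM -cmpA push_morl [RHS]cmpA push_morl -cmpA.
by rewrite push_morr cs_morM -cmpA !push_morr.
Qed.

(* p_* : coslice B -> coslice E, X |-> pushout of X along p *)
Definition change_of_cobase : functor (coslice B) (coslice E) :=
  @Functor (coslice B) (coslice E) push_obj push_mor push_mor1 push_morM.

Program Definition precomp_mor (X Y : coslice E) (f : hom X Y) :
    @hom (coslice B) (CosliceObj (cs_arr X ∘ p)) (CosliceObj (cs_arr Y ∘ p)) :=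
  @CosliceHom _ _ (CosliceObj (cs_arr X ∘ p)) (CosliceObj (cs_arr Y ∘ p))
    (cs_mor f) _.
Next Obligation. by move=> X Y f /=; rewrite cmpA cs_morP. Qed.

(* p^!, the right adjoint of p_* *)
Program Definition precomp : functor (coslice E) (coslice B) :=
  @Functor (coslice E) (coslice B) (fun X => CosliceObj (cs_arr X ∘ p))
    precomp_mor _ _.
Next Obligation. by move=> X; apply: coslice_hom_eq. Qed.
Next Obligation. by move=> *; apply: coslice_hom_eq. Qed.

Program Definition cobase_unit :
    nat_trans (id_functor (coslice B)) (comp_functor precomp change_of_cobase) :=
  @NatTrans _ _ (id_functor (coslice B)) (comp_functor precomp change_of_cobase)
    (fun X => @CosliceHom _ _ X (precomp (push_obj X))
                (po_inl (po X)) (po_square _)) _.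
Next Obligation. by move=> X Y f; apply: coslice_hom_eq; exact: push_morl. Qed.

Definition cobase_counit_component (X : coslice E) :
    hom (push_obj (precomp X)) X :=
  @CosliceHom _ _ (push_obj (precomp X)) X
    (po_desc (po (precomp X)) (cmp1m (cs_arr X ∘ p))) (po_descr _ _).

Lemma cobase_counitl (X : coslice E) :
  cs_mor (cobase_counit_component X) ∘ po_inl (po (precomp X)) = idm (cs_cod X).
Proof. exact: po_descl. Qed.

Lemma cobase_counitr (X : coslice E) :
  cs_mor (cobase_counit_component X) ∘ po_inr (po (precomp X)) = cs_arr X.
Proof. exact: po_descr. Qed.

Program Definition cobase_counit :
    nat_trans (comp_functor change_of_cobase precomp) (id_functor (coslice E)) :=
  @NatTrans _ _ (comp_functor change_of_cobase precomp) (id_functor (coslice E))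
    cobase_counit_component _.
Next Obligation.
move=> X Y f; apply: coslice_hom_eq; apply: po_uniq.
  rewrite !cs_morM -!cmpA cobase_counitl push_morl cmpA cobase_counitl.
  by rewrite cmp1m cmpm1.
by rewrite !cs_morM -!cmpA cobase_counitr push_morr cobase_counitr cs_morP.
Qed.

Program Definition cobase_adjunction : adjunction change_of_cobase precomp :=
  @Adjunction _ _ _ _ cobase_unit cobase_counit _ _.
Next Obligation.
move=> X; apply: coslice_hom_eq; apply: po_uniq.
  by rewrite cs_morM -cmpA push_morl cmpA cobase_counitl.
by rewrite cs_morM -cmpA push_morr cobase_counitr /= cmp1m.
Qed.
Next Obligation. by move=> X; apply: coslice_hom_eq; exact: cobase_counitl. Qed.

Definition codescent : Prop := precomonadic cobase_adjunction.

Definition effective_codescent : Prop := comonadic cobase_adjunction.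

End ChangeOfCobase.

HB.mixin Record isTernaryRing (T : Type) := {
  tern0 : T;
  tern1 : T;
  ternt : T -> T -> T -> T;
  ternq : T -> T -> T -> T;
  ternt0l : forall x y, ternt tern0 x y = y;
  ternt0m : forall x y, ternt x tern0 y = y;
  ternt1l : forall x, ternt tern1 x tern0 = x;
  ternt1m : forall x, ternt x tern1 tern0 = x;
  terntK : forall x y z, ternq x y (ternt x y z) = z;
  ternqK : forall x y z, ternt x y (ternq x y z) = z }.

#[short(type="ternaryRingType")]
HB.structure Definition TernaryRing := { T of isTernaryRing T }.

Arguments tern0 {s}.
Arguments tern1 {s}.

Record tern_hom (R S : ternaryRingType) := TernHom {
  tern_fun :> R -> S;
  tern_hom0 : tern_fun tern0 = tern0;
  tern_hom1 : tern_fun tern1 = tern1;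
  tern_homt : forall x y z,
    tern_fun (ternt x y z) = ternt (tern_fun x) (tern_fun y) (tern_fun z);
  tern_homq : forall x y z,
    tern_fun (ternq x y z) = ternq (tern_fun x) (tern_fun y) (tern_fun z) }.

Lemma tern_hom_eq (R S : ternaryRingType) (f g : tern_hom R S) :
  f =1 g -> f = g.
Proof.
case: f g => [f f0 f1 ft fq] [g g0 g1 gt gq] /= /funext E.
by case: _ / E in g0 g1 gt gq *; congr TernHom.
Qed.

Definition tern_id (R : ternaryRingType) : tern_hom R R :=
  @TernHom R R id erefl erefl (fun _ _ _ => erefl) (fun _ _ _ => erefl).

Program Definition tern_cmp (R S T : ternaryRingType)
    (g : tern_hom S T) (f : tern_hom R S) : tern_hom R T :=
  @TernHom R T (g \o f) _ _ _ _.
Next Obligation. by move=> *; rewrite /= !tern_hom0. Qed.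
Next Obligation. by move=> *; rewrite /= !tern_hom1. Qed.
Next Obligation. by move=> *; rewrite /= !tern_homt. Qed.
Next Obligation. by move=> *; rewrite /= !tern_homq. Qed.

Program Definition TernaryRings : category :=
  @Category ternaryRingType tern_hom tern_id tern_cmp _ _ _.
Next Obligation. by move=> *; apply: tern_hom_eq. Qed.
Next Obligation. by move=> *; apply: tern_hom_eq. Qed.
Next Obligation. by move=> *; apply: tern_hom_eq. Qed.

Inductive term (V : Type) : Type :=
  | TVar of V
  | Tern0
  | Tern1
  | Ternt of term V & term V & term V
  | Ternq of term V & term V & term V.

Fixpoint teval (V : Type) (R : ternaryRingType) (v : V -> R) (s : term V) : R :=
  match s with
  | TVar x => v x
  | Tern0 => tern0
  | Tern1 => tern1
  | Ternt s1 s2 s3 => ternt (teval v s1) (teval v s2) (teval v s3)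
  | Ternq s1 s2 s3 => ternq (teval v s1) (teval v s2) (teval v s3)
  end.

Definition sum_val (U V T : Type) (a : U -> T) (h : V -> T) (x : U + V) : T :=
  match x with inl i => a i | inr j => h j end.

(* The pushout of f and g is the set of terms with constants from X and Y,
   modulo equality of the values in every cocone. *)
Section TernPushout.
Variables (A X Y : ternaryRingType) (f : tern_hom A X) (g : tern_hom A Y).

Definition po_eqv (s s' : term (X + Y)) : Prop :=
  forall (Z : ternaryRingType) (h : tern_hom X Z) (k : tern_hom Y Z),
    (forall a, h (f a) = k (g a)) ->
    teval (sum_val h k) s = teval (sum_val h k) s'.

Definition tern_po : Type :=
  {c : set (term (X + Y)) | exists s, c = po_eqv s}.

Definition po_class (s : term (X + Y)) : tern_po :=
  exist _ (po_eqv s) (ex_intro _ s erefl).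

Definition po_repr (c : tern_po) : term (X + Y) := sval (cid (svalP c)).

Lemma tern_po_eq (c d : tern_po) : sval c = sval d -> c = d.
Proof. by case: c d => [c Hc] [d Hd]; exact: eq_exist. Qed.

Lemma po_classP s s' : po_eqv s s' -> po_class s = po_class s'.
Proof.
move=> E; apply: tern_po_eq; apply: funext => u; apply/propext.
by split=> H Z h k e; rewrite -(H Z h k e) E.
Qed.

Lemma po_reprK : cancel po_repr po_class.
Proof.
by move=> c; apply: tern_po_eq; rewrite /po_repr; case: (cid _) => s /= ->.
Qed.

Lemma po_classK s : po_eqv (po_repr (po_class s)) s.
Proof.
have: sval (po_class s) s by [].
by rewrite -{1}(po_reprK (po_class s)).
Qed.

Let op (o : term (X + Y) -> term (X + Y) -> term (X + Y) -> term (X + Y))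
    (x y z : tern_po) : tern_po :=
  po_class (o (po_repr x) (po_repr y) (po_repr z)).

Let z0 := po_class (Tern0 _).
Let z1 := po_class (Tern1 _).

Lemma po_t0l x y : op (@Ternt _) z0 x y = y.
Proof.
rewrite -[RHS]po_reprK; apply: po_classP => Z h k e /=.
by rewrite (po_classK _ e) ternt0l.
Qed.
Lemma po_t0m x y : op (@Ternt _) x z0 y = y.
Proof.
rewrite -[RHS]po_reprK; apply: po_classP => Z h k e /=.
by rewrite (po_classK _ e) ternt0m.
Qed.
Lemma po_t1l x : op (@Ternt _) z1 x z0 = x.
Proof.
rewrite -[RHS]po_reprK; apply: po_classP => Z h k e /=.
by rewrite !(po_classK _ e) ternt1l.
Qed.
Lemma po_t1m x : op (@Ternt _) x z1 z0 = x.
Proof.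
rewrite -[RHS]po_reprK; apply: po_classP => Z h k e /=.
by rewrite !(po_classK _ e) ternt1m.
Qed.
Lemma po_tK x y z : op (@Ternq _) x y (op (@Ternt _) x y z) = z.
Proof.
rewrite -[RHS]po_reprK; apply: po_classP => Z h k e /=.
by rewrite (po_classK _ e) terntK.
Qed.
Lemma po_qK x y z : op (@Ternt _) x y (op (@Ternq _) x y z) = z.
Proof.
rewrite -[RHS]po_reprK; apply: po_classP => Z h k e /=.
by rewrite (po_classK _ e) ternqK.
Qed.

HB.instance Definition _ :=
  isTernaryRing.Build tern_po po_t0l po_t0m po_t1l po_t1m po_tK po_qK.

Program Definition tern_inl : tern_hom X tern_po :=
  @TernHom X tern_po (fun x => po_class (TVar (inl x))) _ _ _ _.
Next Obligation. by apply: po_classP => Z h k e /=; rewrite tern_hom0. Qed.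
Next Obligation. by apply: po_classP => Z h k e /=; rewrite tern_hom1. Qed.
Next Obligation.
by move=> x y z; apply: po_classP => Z h k e /=; rewrite !(po_classK _ e) tern_homt.
Qed.
Next Obligation.
by move=> x y z; apply: po_classP => Z h k e /=; rewrite !(po_classK _ e) tern_homq.
Qed.

Program Definition tern_inr : tern_hom Y tern_po :=
  @TernHom Y tern_po (fun x => po_class (TVar (inr x))) _ _ _ _.
Next Obligation. by apply: po_classP => Z h k e /=; rewrite tern_hom0. Qed.
Next Obligation. by apply: po_classP => Z h k e /=; rewrite tern_hom1. Qed.
Next Obligation.
by move=> x y z; apply: po_classP => Z h k e /=; rewrite !(po_classK _ e) tern_homt.
Qed.
Next Obligation.
by move=> x y z; apply: po_classP => Z h k e /=; rewrite !(po_classK _ e) tern_homq.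
Qed.

Lemma tern_square : tern_cmp tern_inl f = tern_cmp tern_inr g.
Proof. by apply: tern_hom_eq => a; apply: po_classP => Z h k e /=; rewrite e. Qed.

Section Desc.
Variables (Z : ternaryRingType) (h : tern_hom X Z) (k : tern_hom Y Z).
Hypothesis e : tern_cmp h f = tern_cmp k g.

Lemma desc_compat a : h (f a) = k (g a).
Proof. exact: (congr1 (fun u : tern_hom A Z => u a) e). Qed.

Program Definition tern_desc : tern_hom tern_po Z :=
  @TernHom tern_po Z (fun c => teval (sum_val h k) (po_repr c)) _ _ _ _.
Next Obligation. exact: (po_classK (Tern0 _) desc_compat). Qed.
Next Obligation. exact: (po_classK (Tern1 _) desc_compat). Qed.
Next Obligation.
by move=> x y z; exact: (po_classK (Ternt _ _ _) desc_compat).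
Qed.
Next Obligation.
by move=> x y z; exact: (po_classK (Ternq _ _ _) desc_compat).
Qed.

Lemma tern_descl : tern_cmp tern_desc tern_inl = h.
Proof. by apply: tern_hom_eq => x; exact: (po_classK _ desc_compat). Qed.

Lemma tern_descr : tern_cmp tern_desc tern_inr = k.
Proof. by apply: tern_hom_eq => x; exact: (po_classK _ desc_compat). Qed.

End Desc.

Lemma po_class_t s1 s2 s3 :
  po_class (Ternt s1 s2 s3) = ternt (po_class s1) (po_class s2) (po_class s3).
Proof. by apply: po_classP => Z h k e /=; rewrite !(po_classK _ e). Qed.

Lemma po_class_q s1 s2 s3 :
  po_class (Ternq s1 s2 s3) = ternq (po_class s1) (po_class s2) (po_class s3).
Proof. by apply: po_classP => Z h k e /=; rewrite !(po_classK _ e). Qed.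

Lemma tern_uniq (Z : ternaryRingType) (u v : tern_hom tern_po Z) :
  tern_cmp u tern_inl = tern_cmp v tern_inl ->
  tern_cmp u tern_inr = tern_cmp v tern_inr -> u = v.
Proof.
move=> el er; apply: tern_hom_eq => c; rewrite -(po_reprK c).
elim: (po_repr c) => [[x|y]|||s1 E1 s2 E2 s3 E3|s1 E1 s2 E2 s3 E3].
- exact: (congr1 (fun w : tern_hom X Z => w x) el).
- exact: (congr1 (fun w : tern_hom Y Z => w y) er).
- exact: etrans (tern_hom0 u) (esym (tern_hom0 v)).
- exact: etrans (tern_hom1 u) (esym (tern_hom1 v)).
- by rewrite po_class_t !tern_homt E1 E2 E3.
- by rewrite po_class_q !tern_homq E1 E2 E3.
Qed.

End TernPushout.

Definition TernaryRings_pushouts : pushouts TernaryRings :=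
  fun (A X Y : ternaryRingType) (f : tern_hom A X) (g : tern_hom A Y) =>
    @Pushout TernaryRings A X Y f g (tern_po f g : ternaryRingType)
      (tern_inl f g) (tern_inr f g) (tern_square f g) (@tern_desc A X Y f g)
      (@tern_descl A X Y f g) (@tern_descr A X Y f g) (@tern_uniq A X Y f g).

Record congruence (R : ternaryRingType) (th : R -> R -> Prop) : Prop := Congruence {
  cong_refl : forall x, th x x;
  cong_sym : forall x y, th x y -> th y x;
  cong_trans : forall x y z, th x y -> th y z -> th x z;
  cong_t : forall x x' y y' z z', th x x' -> th y y' -> th z z' ->
    th (ternt x y z) (ternt x' y' z');
  cong_q : forall x x' y y' z z', th x x' -> th y y' -> th z z' ->
    th (ternq x y z) (ternq x' y' z') }.

(* [inl i] stands for the variable x_i and [inr j] for y_j *)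
Definition ideal_term (m n : nat) (tau : term ('I_m + 'I_n)) : Prop :=
  forall (R : ternaryRingType) (a : 'I_m -> R),
    teval (sum_val a (fun _ : 'I_n => tern0)) tau = tern0.

Definition zero_ideal (R : ternaryRingType) (I : set R) : Prop :=
  I !=set0 /\
  forall (m n : nat) (tau : term ('I_m + 'I_n)), ideal_term tau ->
    forall (a : 'I_m -> R) (h : 'I_n -> R), (forall j, I (h j)) ->
      I (teval (sum_val a h) tau).

Definition congruence_extension (R S : ternaryRingType) (p : tern_hom R S) : Prop :=
  forall th : R -> R -> Prop, congruence th ->
    exists th' : S -> S -> Prop,
      congruence th' /\ forall x y : R, th' (p x) (p y) <-> th x y.

Definition zero_ideal_extension (R S : ternaryRingType) (p : tern_hom R S) : Prop :=
  forall I : set R, zero_ideal I ->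
    exists I' : set S, zero_ideal I' /\ p @^-1` I' = I.

Section Closure.
Variable S : ternaryRingType.
Implicit Types x y : S.

Definition tau1 x y : S := ternq tern1 (ternt tern1 x y) x.

Definition tau2 x1 x2 x3 y : S :=
  ternq tern1 x3 (ternq x1 x2 (ternt tern1 (ternt x1 x2 x3) y)).

Definition tau3 x1 x2 x3 y1 y2 y3 : S :=
  ternq tern1 (ternt x1 x2 x3)
    (ternt (ternt tern1 x1 y1) (ternt tern1 x2 y2) (ternt tern1 x3 y3)).

Definition tau_step (Y : set S) : set S :=
  Y `|`
  [set z | exists a1 a2 a3 h1 h2 h3, [/\ Y h1, Y h2, Y h3 &
    [\/ z = tau1 a1 h1, z = tau2 a1 a2 a3 h1 | z = tau3 a1 a2 a3 h1 h2 h3]]].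

(* the set Y_i, starting from Y_0 *)
Definition tau_iter (Y0 : set S) (i : nat) : set S := iter i tau_step Y0.

End Closure.

(* Main.v *)
(** Ideal closure under [tau1], [tau2], [tau3] is exactly what makes
    [x ~ y := J (ternq 1 y x)] a congruence with zero class [J]; hence the
    0-ideals are the zero classes of congruences, and the 0-ideal generated by
    [I] is the union of the sets [Y_i].

    For codescent, let [R -> X] be any homomorphism and [W] the pushout of [X]
    and [S].  Faithfulness of the comparison functor, tested on the kernel pair
    of [X -> W] for [X = R / th], makes [X -> W] injective, so that the kernel
    of [S -> W] extends [th].  Conversely, under the congruence extension
    property, the images of [X] and [S] in [W] meet in the image of [R], and
    every element of [W] has a unique normal form as a reduced term in elements
    of these two images.  A map of pushouts [X + S -> X' + S] induced by an
    injective [X -> X'] acts on normal forms leaf by leaf.  For a coalgebra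
    [xi : X -> W], coassociativity therefore forces every leaf from [X] of the
    normal form of [xi x] to lie in the equalizer [A] of [xi] and the coprojection
    [X -> W], which shows that [X] is the pushout of [A] and [S]. *)

Require Import Defs.
From HB Require Import structures.
From mathcomp Require Import all_boot.
From mathcomp Require Import boolp classical_sets.

Set Implicit Arguments.
Unset Strict Implicit.
Unset Printing Implicit Defensive.

Local Open Scope classical_set_scope.

(** * Ideals and congruences *)

Section Ideals.
Variable R : ternaryRingType.
Implicit Types (x y z : R) (J : set R).

Lemma ternq0m x y : ternq x tern0 y = y.
Proof. by rewrite -{1}(ternt0m x y) terntK. Qed.

Lemma ternq1l x : ternq tern1 x x = tern0.
Proof. by rewrite -{2}(ternt1l x) terntK. Qed.

Lemma ternqm1 x : ternq x tern1 x = tern0.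
Proof. by rewrite -{2}(ternt1m x) terntK. Qed.

Definition tau_closed J : Prop :=
  [/\ J tern0, forall x h, J h -> J (tau1 x h),
      forall x1 x2 x3 h, J h -> J (tau2 x1 x2 x3 h)
    & forall x1 x2 x3 h1 h2 h3, J h1 -> J h2 -> J h3 ->
        J (tau3 x1 x2 x3 h1 h2 h3)].

(** [ternq tern1 y x] is the unique [h] with [x = t(1, y, h)], so it plays the part of a difference
    [x - y]. *)
Definition ideal_rel J x y : Prop := J (ternq tern1 y x).

Lemma ideal_relP J x y :
  ideal_rel J x y <-> exists2 h, J h & x = ternt tern1 y h.
Proof.
split=> [Jxy|[h Jh ->]]; last by rewrite /ideal_rel terntK.
by exists (ternq tern1 y x); rewrite ?ternqK.
Qed.

(** Closure under [tau1], [tau3] and [tau2] gives, in this order, symmetry, compatibility with [t]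
    and compatibility with [q] in its last argument. Transitivity comes from compatibility with [t],
    because [z = t(1, z, 0)] and every [h] in [J] is related to [0]. *)
Lemma congruence_ideal_rel J : tau_closed J -> congruence (ideal_rel J).
Proof.
case=> J0 J1 J2 J3.
have refl x : ideal_rel J x x by rewrite /ideal_rel ternq1l.
have sym x y : ideal_rel J x y -> ideal_rel J y x.
  by case/ideal_relP=> h Jh ->; exact: J1.
have compt x x' y y' z z' : ideal_rel J x x' -> ideal_rel J y y' ->
    ideal_rel J z z' -> ideal_rel J (ternt x y z) (ternt x' y' z').
  move=> /ideal_relP[h1 H1 ->] /ideal_relP[h2 H2 ->] /ideal_relP[h3 H3 ->].
  exact: J3.
have trans x y z : ideal_rel J x y -> ideal_rel J y z -> ideal_rel J x z.
  case/ideal_relP=> h Jh -> yz; rewrite -[z]ternt1l.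
  by apply: compt; rewrite // /ideal_rel ternq0m.
have compq3 x y z z' : ideal_rel J z z' ->
    ideal_rel J (ternq x y z) (ternq x y z').
  case/ideal_relP=> h Jh ->; rewrite -{1}(ternqK x y z').
  exact: J2.
split=> // x x' y y' z z' xx' yy' zz'.
apply: (trans _ (ternq x y z')); first exact: compq3.
(* With [w = q(x, y, z')] the two sides become [q(x', y', t(x', y', w))] and
   [q(x', y', t(x, y, w))], which differ only in the last argument of [q]. *)
rewrite -{2}(ternqK x y z') -{1}(terntK x' y' (ternq x y z')).
by apply: compq3; apply: compt => //; exact: sym.
Qed.

Lemma ideal_rel_0 J x : ideal_rel J x tern0 <-> J x.
Proof. by rewrite /ideal_rel ternq0m. Qed.

Lemma congruence_teval (V : Type) (th : R -> R -> Prop) (v w : V -> R)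
    (s : term V) :
  congruence th -> (forall i, th (v i) (w i)) -> th (teval v s) (teval w s).
Proof.
move=> cth vw; elim: s => //= *;
by [exact: (cong_refl cth)|exact: (cong_t cth)|exact: (cong_q cth)].
Qed.

Lemma zero_class_ideal (th : R -> R -> Prop) :
  congruence th -> zero_ideal [set x | th x tern0].
Proof.
move=> cth; split; first by exists tern0; exact: cong_refl.
move=> m n tau idt a h Ih /=; rewrite -(idt R a).
apply: congruence_teval => // -[i|j] /=; [exact: cong_refl|exact: Ih].
Qed.

(** Since [x = t(1, y, q(1, y, x))] and [y = t(1, y, 0)], a congruence is determined by its zero
    class. *)
Lemma congruence_sub0 (th : R -> R -> Prop) x y : congruence th ->
  th (ternq tern1 y x) tern0 <-> th x y.
Proof.
move=> cth; split=> H.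
  rewrite -[x](ternqK tern1 y) -[y in X in th _ X]ternt1l.
  by apply: cong_t => //; exact: cong_refl.
by rewrite -(ternq1l y); apply: cong_q => //; exact: cong_refl.
Qed.

Let val3 (a b c : R) (i : 'I_3) : R :=
  match val i with 0 => a | 1 => b | _ => c end.

Let X k (lt_k3 : k < 3) : term ('I_3 + 'I_3) := TVar (inl (Ordinal lt_k3)).
Let Y k (lt_k3 : k < 3) : term ('I_3 + 'I_3) := TVar (inr (Ordinal lt_k3)).
Let x0 := @X 0 isT. Let x1 := @X 1 isT. Let x2 := @X 2 isT.
Let y0 := @Y 0 isT. Let y1 := @Y 1 isT. Let y2 := @Y 2 isT.
Let I1 := Tern1 ('I_3 + 'I_3).

(** With all [y] equal to [0], each [tau] collapses to the form [q(1, x, x) = 0], by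
    [t(1, x, 0) = x] and, for [tau2], by [q] undoing [t]. All three are written with three variables
    of each kind, and missing arguments are filled by repetition. *)
Lemma zero_ideal_tau_closed J : zero_ideal J -> tau_closed J.
Proof.
case=> _ cl.
have cl3 tau : ideal_term tau -> forall a1 a2 a3 h1 h2 h3,
    J h1 -> J h2 -> J h3 ->
    J (teval (sum_val (val3 a1 a2 a3) (val3 h1 h2 h3)) tau).
  move=> idt a1 a2 a3 h1 h2 h3 H1 H2 H3; apply: (cl _ _ _ idt).
  by move=> j; rewrite /= /val3; case: (val j) => [|[]].
split=> [|x h Jh|a1 a2 a3 h Jh|a1 a2 a3 h1 h2 h3 H1 H2 H3].
- by apply: (cl 0 0 (Tern0 _) _ (fun=> tern0) (fun=> tern0)) => [T a|[]].
- apply: (cl3 (Ternq I1 (Ternt I1 x0 y0) x0) _ x x x h h h) => // T a /=.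
  by rewrite ternt1l /= -{2}(ternt1l (a _)) terntK.
- apply: (cl3 (Ternq I1 x2 (Ternq x0 x1 (Ternt I1 (Ternt x0 x1 x2) y0)))
               _ a1 a2 a3 h h h) => // T a /=.
  by rewrite ternt1l terntK -{2}(ternt1l (a _)) terntK.
- apply: (cl3 (Ternq I1 (Ternt x0 x1 x2)
                (Ternt (Ternt I1 x0 y0) (Ternt I1 x1 y1) (Ternt I1 x2 y2)))
               _ a1 a2 a3 h1 h2 h3) => // T a /=.
  by rewrite !ternt1l -[X in ternq _ _ X]ternt1l terntK.
Qed.

Lemma sub_tau_iter J i j : i <= j -> tau_iter J i `<=` tau_iter J j.
Proof.
move=> /subnK <-; elim: (j - i) => // k IH x /IH; exact: or_introl.
Qed.

Lemma tau_closed_bigcup J : J tern0 -> tau_closed (\bigcup_i tau_iter J i).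
Proof.
move=> J0; split; first by exists 0.
- move=> x h [i _ Hh]; exists i.+1 => //=; right.
  by exists x, x, x, h, h, h; split=> //; constructor 1.
- move=> a1 a2 a3 h [i _ Hh]; exists i.+1 => //=; right.
  by exists a1, a2, a3, h, h, h; split=> //; constructor 2.
- move=> a1 a2 a3 h1 h2 h3 [i _ H1] [j _ H2] [k _ H3].
  (* The stages increase, so all three inputs lie in the largest one, and the value appears one
     stage later. *)
  exists (maxn i (maxn j k)).+1 => //=; right.
  exists a1, a2, a3, h1, h2, h3; split; last by constructor 3.
  + by apply: sub_tau_iter H1; rewrite leq_max leqnn.
  + by apply: sub_tau_iter H2; rewrite !leq_max leqnn orbT.
  + by apply: sub_tau_iter H3; rewrite !leq_max leqnn !orbT.
Qed.

Lemma tau_iter_sub J K i : tau_closed K -> J `<=` K -> tau_iter J i `<=` K.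
Proof.
move=> [_ K1 K2 K3] JK; elim: i => // i IH x /= [/IH //|].
move=> [a1 [a2 [a3 [h1 [h2 [h3 [/IH H1 /IH H2 /IH H3]]]]]]].
by case=> ->; [exact: K1|exact: K2|exact: K3].
Qed.

End Ideals.

(** * Extending congruences, extending ideals, and the generated ideal *)

Section ExtensionProperties.
Variables (R S : ternaryRingType) (p : tern_hom R S).

(** [I] is the zero class of [ideal_rel I], and the zero class of an extension of this congruence is
    an ideal extending [I]. *)
Lemma congruence_extension_ideal :
  congruence_extension p -> zero_ideal_extension p.
Proof.
move=> cep I idI.
have [|th [cth thE]] := cep (ideal_rel I).
  exact/congruence_ideal_rel/zero_ideal_tau_closed.
exists [set x | th x tern0]; split; first exact: zero_class_ideal.
apply/seteqP; split=> x /=; rewrite -(tern_hom0 p) thE; first by move/ideal_rel_0.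
by move=> Ix; apply/ideal_rel_0.
Qed.

Lemma zero_ideal_extension_tau : zero_ideal_extension p ->
  forall I : set R, zero_ideal I -> p @^-1` (\bigcup_i tau_iter (p @` I) i) = I.
Proof.
move=> iep I idI; apply/seteqP; split=> [x [i _ Hx]|x Ix]; last first.
  by exists 0 => //; exists x.
have [J [/zero_ideal_tau_closed tJ JI]] := iep I idI.
rewrite -JI; apply: tau_iter_sub Hx => // _ [y Iy <-].
by move: Iy; rewrite -{1}JI.
Qed.

(** The extension is the difference relation of the closure of the zero class of [th]. It restricts
    to [th] because differences of elements of [R] are computed in [R], where they detect [th]. *)
Lemma tau_congruence_extension :
  (forall I : set R, zero_ideal I ->
    p @^-1` (\bigcup_i tau_iter (p @` I) i) = I) ->
  congruence_extension p.
Proof.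
move=> H th cth; pose I := [set x | th x tern0].
have idI : zero_ideal I := zero_class_ideal cth.
exists (ideal_rel (\bigcup_i tau_iter (p @` I) i)); split.
  apply/congruence_ideal_rel/tau_closed_bigcup.
  by exists tern0; [exact: cong_refl|exact: tern_hom0].
move=> x y; rewrite /ideal_rel -(tern_hom1 p) -tern_homq.
rewrite -(congruence_sub0 x y cth).
by rewrite -[X in _ <-> X]/(I _) -{2}(H I idI).
Qed.

End ExtensionProperties.

(** * Equivalences of categories *)

Lemma iso_cancelr (C : category) (A B D : C) (e : hom A B) (f g : hom B D) :
  is_iso e -> f ∘ e = g ∘ e -> f = g.
Proof.
by case=> e' [_ ee'] fg; rewrite -[f]cmpm1 -[g]cmpm1 -ee' !cmpA fg.
Qed.

Lemma iso_cancell (C : category) (A B D : C) (e : hom B D) (f g : hom A B) :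
  is_iso e -> e ∘ f = e ∘ g -> f = g.
Proof.
by case=> e' [e'e _] fg; rewrite -[f]cmp1m -[g]cmp1m -e'e -!cmpA fg.
Qed.

Lemma faithful_of_iso_id (C D : category) (F : functor C D) (G : functor D C) :
  naturally_isomorphic (comp_functor G F) (id_functor C) -> faithful F.
Proof.
case=> eta eta_iso A B f g fg; apply: (iso_cancelr (eta_iso A)).
have /= -> := naturality eta f; have /= -> := naturality eta g.
by rewrite fg.
Qed.

Lemma equivalence_fully_faithful (C D : category) (F : functor C D) :
  is_equivalence F -> full F /\ faithful F.
Proof.
case=> G [GF FG]; have fF := faithful_of_iso_id GF.
have fG := faithful_of_iso_id FG; split=> // A B g.
have [eta eta_iso] := GF; have [e [eA Ae]] := eta_iso A.
(* [G g] is conjugated by the isomorphism from [G F] to the identity. This gives [G (F f) = G g],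
   and [G] is faithful. *)
exists (eta B ∘ fmap G g ∘ e); apply: fG; apply: (iso_cancell (eta_iso B)).
have /= <- := naturality eta (eta B ∘ fmap G g ∘ e).
by rewrite -!cmpA eA cmpm1.
Qed.

Section EssentiallySurjective.
Variables (C D : category) (F : functor C D).
Hypotheses (fullF : full F) (faithfulF : faithful F).
Hypothesis surjF : forall Y : D, exists X : C, exists e : hom (F X) Y, is_iso e.

Let lift (A B : C) (g : hom (F A) (F B)) : hom A B := sval (cid (fullF g)).

Let liftK (A B : C) (g : hom (F A) (F B)) : fmap F (lift g) = g.
Proof. exact: svalP (cid (fullF g)). Qed.

Let G0 (Y : D) : C := sval (cid (surjF Y)).
Let e (Y : D) : hom (F (G0 Y)) Y := sval (cid (svalP (cid (surjF Y)))).
Let e_iso (Y : D) : is_iso (e Y) := svalP (cid (svalP (cid (surjF Y)))).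
Let e' (Y : D) : hom Y (F (G0 Y)) := sval (cid (e_iso Y)).
Let e'e Y : e' Y ∘ e Y = idm _ := (svalP (cid (e_iso Y))).1.
Let ee' Y : e Y ∘ e' Y = idm _ := (svalP (cid (e_iso Y))).2.

Let G1 (Y Z : D) (g : hom Y Z) : hom (G0 Y) (G0 Z) := lift (e' Z ∘ g ∘ e Y).

Let G1_1 Y : G1 (idm Y) = idm (G0 Y).
Proof. by apply: faithfulF; rewrite liftK cmpm1 e'e fmap1. Qed.

Let G1_M (X Y Z : D) (g : hom Y Z) (f : hom X Y) : G1 (g ∘ f) = G1 g ∘ G1 f.
Proof.
apply: faithfulF; rewrite fmapM !liftK -!cmpA; congr cmp; congr cmp.
by rewrite !cmpA ee' cmp1m.
Qed.

Let G : functor D C := Functor G1_1 G1_M.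

Let counit_nat (Y Z : D) (g : hom Y Z) :
  fmap (id_functor D) g ∘ e Y = e Z ∘ fmap (comp_functor F G) g.
Proof. by rewrite /= liftK !cmpA ee' cmp1m. Qed.

Let unit_nat (A B : C) (f : hom A B) :
  fmap (id_functor C) f ∘ lift (e (F A)) =
  lift (e (F B)) ∘ fmap (comp_functor G F) f.
Proof. by apply: faithfulF; rewrite !fmapM !liftK !cmpA ee' cmp1m. Qed.

Lemma fully_faithful_equivalence : is_equivalence F.
Proof.
exists G; split; last first.
  by exists (@NatTrans _ _ (comp_functor F G) (id_functor D) _ counit_nat); exact: e_iso.
exists (@NatTrans _ _ (comp_functor G F) (id_functor C) _ unit_nat) => A /=.
exists (lift (e' (F A))); split; apply: faithfulF; rewrite fmapM !liftK.
  by rewrite e'e fmap1.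
by rewrite ee' fmap1.
Qed.

End EssentiallySurjective.

Lemma coslice_iso (C : category) (B : C) (X Y : coslice B) (f : hom X Y) :
  is_iso (cs_mor f) -> is_iso f.
Proof.
case=> g [gf fg].
have gP : g ∘ cs_arr Y = cs_arr X by rewrite -(cs_morP f) cmpA gf cmp1m.
by exists (CosliceHom gP); split; exact: coslice_hom_eq.
Qed.

Lemma coalgebra_iso (D : category) (W : comonad D)
    (X Y : coalgebra_category W) (f : hom X Y) :
  is_iso (coalg_mor f) -> is_iso f.
Proof.
case=> g [gf fg].
have gP : coalg_str X ∘ g = fmap W g ∘ coalg_str Y.
  rewrite -[coalg_str Y]cmpm1 -fg [coalg_str Y ∘ _]cmpA coalg_morP !cmpA.
  by rewrite -fmapM gf fmap1 cmp1m.
by exists (CoalgebraHom gP); split; exact: coalgebra_hom_eq.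
Qed.

(** * Products, equalizers and quotients of ternary rings *)

Lemma tern_hom_ext (R S : ternaryRingType) (f g : tern_hom R S) :
  f = g -> forall x, f x = g x.
Proof. by move=> ->. Qed.

Lemma tern_hom_inv_q (R S : ternaryRingType) (f : R -> S) :
  (forall x y z, f (ternt x y z) = ternt (f x) (f y) (f z)) ->
  forall x y z, f (ternq x y z) = ternq (f x) (f y) (f z).
Proof. by move=> ft x y z; rewrite -{2}(ternqK x y z) ft terntK. Qed.

Definition mk_tern_hom (R S : ternaryRingType) (f : R -> S)
    (f0 : f tern0 = tern0) (f1 : f tern1 = tern1)
    (ft : forall x y z, f (ternt x y z) = ternt (f x) (f y) (f z)) :
    tern_hom R S :=
  TernHom f0 f1 ft (tern_hom_inv_q ft).

(** Preimages are chosen, and injectivity of [u] makes the choice a homomorphism. This serves for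
    lifts to equalizers, inverses of bijections and fullness of the comparison functor. *)
Lemma tern_hom_factor (A B W : ternaryRingType) (u : tern_hom B W)
    (v : tern_hom A W) :
  injective u -> (forall a, exists b, u b = v a) ->
  exists f : tern_hom A B, forall a, u (f a) = v a.
Proof.
move=> uI /choice[f uf].
have f0 : f tern0 = tern0 by apply: uI; rewrite uf !tern_hom0.
have f1 : f tern1 = tern1 by apply: uI; rewrite uf !tern_hom1.
have ft x y z : f (ternt x y z) = ternt (f x) (f y) (f z).
  by apply: uI; rewrite uf !tern_homt !uf.
by exists (mk_tern_hom f0 f1 ft).
Qed.

Section Product.
Variables R S : ternaryRingType.

Let op (f : forall T : ternaryRingType, T -> T -> T -> T) (x y z : R * S) :
  R * S := (f R x.1 y.1 z.1, f S x.2 y.2 z.2).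

Fact prod_t0l x y : op (@ternt) (tern0, tern0) x y = y.
Proof. by case: y => *; congr pair; rewrite /= ternt0l. Qed.
Fact prod_t0m x y : op (@ternt) x (tern0, tern0) y = y.
Proof. by case: y => *; congr pair; rewrite /= ternt0m. Qed.
Fact prod_t1l x : op (@ternt) (tern1, tern1) x (tern0, tern0) = x.
Proof. by case: x => *; congr pair; rewrite /= ternt1l. Qed.
Fact prod_t1m x : op (@ternt) x (tern1, tern1) (tern0, tern0) = x.
Proof. by case: x => *; congr pair; rewrite /= ternt1m. Qed.
Fact prod_tK x y z : op (@ternq) x y (op (@ternt) x y z) = z.
Proof. by case: z => *; congr pair; rewrite /= terntK. Qed.
Fact prod_qK x y z : op (@ternt) x y (op (@ternq) x y z) = z.
Proof. by case: z => *; congr pair; rewrite /= ternqK. Qed.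

HB.instance Definition _ := isTernaryRing.Build (R * S)%type
  prod_t0l prod_t0m prod_t1l prod_t1m prod_tK prod_qK.

Definition tern_fst : tern_hom (R * S)%type R :=
  @TernHom (R * S)%type R fst erefl erefl (fun _ _ _ => erefl) (fun _ _ _ => erefl).

Definition tern_snd : tern_hom (R * S)%type S :=
  @TernHom (R * S)%type S snd erefl erefl (fun _ _ _ => erefl) (fun _ _ _ => erefl).

Program Definition tern_pair (T : ternaryRingType) (f : tern_hom T R)
    (g : tern_hom T S) : tern_hom T (R * S)%type :=
  @mk_tern_hom T (R * S)%type (fun x => (f x, g x)) _ _ _.
Next Obligation. by move=> *; rewrite !tern_hom0. Qed.
Next Obligation. by move=> *; rewrite !tern_hom1. Qed.
Next Obligation. by move=> *; rewrite !tern_homt. Qed.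

End Product.

Section Equalizer.
Variables (T U : ternaryRingType) (f g : tern_hom T U).

Definition tern_eq : Type := {x : T | f x = g x}.

Fact tern_eq_inj : injective (fun x : tern_eq => sval x).
Proof. by move=> [x ex] [y ey] /= E; exact: eq_exist. Qed.

Definition tern_eq_0 : tern_eq :=
  exist _ tern0 (etrans (tern_hom0 f) (esym (tern_hom0 g))).
Definition tern_eq_1 : tern_eq :=
  exist _ tern1 (etrans (tern_hom1 f) (esym (tern_hom1 g))).
Fact tern_eq_t_proof (x y z : tern_eq) :
  f (ternt (sval x) (sval y) (sval z)) = g (ternt (sval x) (sval y) (sval z)).
Proof. by rewrite !tern_homt !(svalP x, svalP y, svalP z). Qed.
Fact tern_eq_q_proof (x y z : tern_eq) :
  f (ternq (sval x) (sval y) (sval z)) = g (ternq (sval x) (sval y) (sval z)).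
Proof. by rewrite !tern_homq !(svalP x, svalP y, svalP z). Qed.
Definition tern_eq_t (x y z : tern_eq) : tern_eq := exist _ _ (tern_eq_t_proof x y z).
Definition tern_eq_q (x y z : tern_eq) : tern_eq := exist _ _ (tern_eq_q_proof x y z).

Fact tern_eq_t0l x y : tern_eq_t tern_eq_0 x y = y.
Proof. by apply: tern_eq_inj; rewrite /= ternt0l. Qed.
Fact tern_eq_t0m x y : tern_eq_t x tern_eq_0 y = y.
Proof. by apply: tern_eq_inj; rewrite /= ternt0m. Qed.
Fact tern_eq_t1l x : tern_eq_t tern_eq_1 x tern_eq_0 = x.
Proof. by apply: tern_eq_inj; rewrite /= ternt1l. Qed.
Fact tern_eq_t1m x : tern_eq_t x tern_eq_1 tern_eq_0 = x.
Proof. by apply: tern_eq_inj; rewrite /= ternt1m. Qed.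
Fact tern_eq_tK x y z : tern_eq_q x y (tern_eq_t x y z) = z.
Proof. by apply: tern_eq_inj; rewrite /= terntK. Qed.
Fact tern_eq_qK x y z : tern_eq_t x y (tern_eq_q x y z) = z.
Proof. by apply: tern_eq_inj; rewrite /= ternqK. Qed.

HB.instance Definition _ := isTernaryRing.Build tern_eq
  tern_eq_t0l tern_eq_t0m tern_eq_t1l tern_eq_t1m tern_eq_tK tern_eq_qK.

Definition tern_eq_incl : tern_hom tern_eq T :=
  @TernHom tern_eq T (fun x => sval x) erefl erefl
    (fun _ _ _ => erefl) (fun _ _ _ => erefl).

Lemma tern_eq_lift (R : ternaryRingType) (h : tern_hom R T) :
  (forall r, f (h r) = g (h r)) ->
  exists k : tern_hom R tern_eq, forall r, tern_eq_incl (k r) = h r.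
Proof.
move=> e; apply: tern_hom_factor; first exact: tern_eq_inj.
by move=> r; exists (exist _ (h r) (e r)).
Qed.

End Equalizer.

Section Quotient.
Variables (R : ternaryRingType) (th : R -> R -> Prop).
Hypothesis cth : congruence th.

Definition tern_quo : Type := {c : set R | exists x, c = th x}.

Definition quo_class (x : R) : tern_quo := exist _ (th x) (ex_intro _ x erefl).

Definition quo_repr (c : tern_quo) : R := sval (cid (svalP c)).

Fact quo_inj : injective (fun c : tern_quo => sval c).
Proof. by move=> [c ec] [d ed] /= E; exact: eq_exist. Qed.

Lemma quo_classP x y : quo_class x = quo_class y <-> th x y.
Proof.
split=> [/(congr1 (fun c : tern_quo => sval c y)) /= ->|xy].
  exact: (cong_refl cth).
apply: quo_inj; apply/funext => z /=; apply/propext; split=> [xz|yz].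
  by apply: (cong_trans cth) xz; exact: (cong_sym cth).
exact: (cong_trans cth xy).
Qed.

Lemma quo_reprK c : quo_class (quo_repr c) = c.
Proof. by apply: quo_inj; rewrite /quo_repr; case: (cid _) => x /= <-. Qed.

Lemma quo_classK x : th (quo_repr (quo_class x)) x.
Proof. by apply/quo_classP; rewrite quo_reprK. Qed.

Let op (f : R -> R -> R -> R) (x y z : tern_quo) : tern_quo :=
  quo_class (f (quo_repr x) (quo_repr y) (quo_repr z)).

Let op_t x y z : op (@ternt R) (quo_class x) (quo_class y) (quo_class z) =
  quo_class (ternt x y z).
Proof. by apply/quo_classP; apply: (cong_t cth); exact: quo_classK. Qed.

Let op_q x y z : op (@ternq R) (quo_class x) (quo_class y) (quo_class z) =
  quo_class (ternq x y z).
Proof. by apply/quo_classP; apply: (cong_q cth); exact: quo_classK. Qed.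

Fact quo_t0l x y : op (@ternt R) (quo_class tern0) x y = y.
Proof. by rewrite -(quo_reprK x) -(quo_reprK y) op_t ternt0l. Qed.
Fact quo_t0m x y : op (@ternt R) x (quo_class tern0) y = y.
Proof. by rewrite -(quo_reprK x) -(quo_reprK y) op_t ternt0m. Qed.
Fact quo_t1l x : op (@ternt R) (quo_class tern1) x (quo_class tern0) = x.
Proof. by rewrite -(quo_reprK x) op_t ternt1l. Qed.
Fact quo_t1m x : op (@ternt R) x (quo_class tern1) (quo_class tern0) = x.
Proof. by rewrite -(quo_reprK x) op_t ternt1m. Qed.
Fact quo_tK x y z : op (@ternq R) x y (op (@ternt R) x y z) = z.
Proof.
by rewrite -(quo_reprK x) -(quo_reprK y) -(quo_reprK z) op_t op_q terntK.
Qed.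
Fact quo_qK x y z : op (@ternt R) x y (op (@ternq R) x y z) = z.
Proof.
by rewrite -(quo_reprK x) -(quo_reprK y) -(quo_reprK z) op_q op_t ternqK.
Qed.

Definition quo_tern : ternaryRingType :=
  HB.pack tern_quo (isTernaryRing.Build tern_quo
    quo_t0l quo_t0m quo_t1l quo_t1m quo_tK quo_qK).

Lemma quotient_exists : exists (Q : ternaryRingType) (q : tern_hom R Q),
  (forall c, exists x, q x = c) /\ forall x y, q x = q y <-> th x y.
Proof.
exists quo_tern.
exists (@mk_tern_hom R quo_tern quo_class erefl erefl
          (fun x y z => esym (op_t x y z))).
split=> [c|x y]; last exact: quo_classP.
by exists (quo_repr c); exact: quo_reprK.
Qed.

End Quotient.

Definition tern_ker (R S : ternaryRingType) (f : tern_hom R S) (x y : R) : Prop :=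
  f x = f y.

Lemma congruence_tern_ker (R S : ternaryRingType) (f : tern_hom R S) :
  congruence (tern_ker f).
Proof.
rewrite /tern_ker; split=> [//|//|x y z -> //||] x x' y y' z z' ex ey ez.
  by rewrite !tern_homt ex ey ez.
by rewrite !tern_homq ex ey ez.
Qed.

(** * Reduced terms over a partial ternary ring *)

(* [pt_t a b c d] says that [t(a, b, c)] is defined with value [d], i.e. that
   [q(a, b, d)] is defined with value [c]; elements outside [pt_dom] are junk. *)
Record partial_tern := PartialTern {
  pt_sort :> Type;
  pt0 : pt_sort;
  pt1 : pt_sort;
  pt_dom : set pt_sort;
  pt_t : pt_sort -> pt_sort -> pt_sort -> pt_sort -> Prop;
  pt_dom0 : pt_dom pt0;
  pt_dom1 : pt_dom pt1;
  pt_dom_t : forall a b c d, pt_t a b c d -> pt_dom c /\ pt_dom d;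
  pt_fun : forall a b c d d', pt_t a b c d -> pt_t a b c d' -> d = d';
  pt_inj : forall a b c c' d, pt_t a b c d -> pt_t a b c' d -> c = c';
  pt_t0l : forall b c d, pt_t pt0 b c d -> d = c;
  pt_t0m : forall a c d, pt_t a pt0 c d -> d = c;
  pt_t1l : forall b c d, pt_t pt1 b c d -> (c = pt0 <-> d = b);
  pt_t1m : forall a c d, pt_t a pt1 c d -> (c = pt0 <-> d = a);
  pt_triv : pt0 = pt1 -> forall a, pt_dom a -> a = pt0 }.

Section ReducedTerms.
Variable P : partial_tern.
Implicit Types (u v w z : term P).

Local Notation O := (TVar (pt0 P)).
Local Notation I := (TVar (pt1 P)).

(* [rstep u v w z] forces [t(u, v, w) = z], equivalently [q(u, v, z) = w]. *)
Variant rstep u v w z : Prop :=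
  | Rstep0l of u = O & z = w
  | Rstep0m of v = O & z = w
  | Rstep1l of u = I & w = O & z = v
  | Rstep1m of v = I & w = O & z = u
  | RstepD a b c d of u = TVar a & v = TVar b & w = TVar c & z = TVar d
      & pt_t a b c d.

(** Normal forms. The constants are represented by the leaves [pt0] and [pt1], hence [Tern0] and
    [Tern1] are excluded. The last two conditions at a node forbid a value already forced by [rstep]
    and a cancellation between [t] and [q]. *)
Fixpoint reduced (s : term P) : Prop :=
  match s with
  | TVar a => pt_dom a
  | Tern0 | Tern1 => False
  | Ternt u v w => [/\ reduced u, reduced v, reduced w,
      ~ exists z, rstep u v w z & ~ exists z, w = Ternq u v z]
  | Ternq u v z => [/\ reduced u, reduced v, reduced z,
      ~ exists w, rstep u v w z & ~ exists w, z = Ternt u v w]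
  end.

(** The degenerate case. If [0 = 1], the clauses of [rstep] for [0] and for [1] conflict, but then
    any compound term has a redex at an innermost node, whose first argument is [0]. *)
Lemma reduced_triv s : pt0 P = pt1 P -> reduced s -> s = O.
Proof.
move=> e01; elim: s => //= [a La|u IHu v _ w _|u IHu v _ w _].
- by rewrite (pt_triv e01 La).
- by case=> /IHu uO _ _ []; exists w; exact: Rstep0l.
- by case=> /IHu uO _ _ []; exists w; exact: Rstep0l.
Qed.

Ltac term_inj := subst; repeat match goal with
  | H : @TVar _ _ = @TVar _ _ |- _ => injection H => {H} ?; subst end.

Ltac rstep_solve := term_inj; try congruence;
  match goal with
  | H : pt_t (pt0 P) _ _ _ |- _ => have := pt_t0l H
  | H : pt_t _ (pt0 P) _ _ |- _ => have := pt_t0m H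
  | H : pt_t (pt1 P) _ _ _ |- _ => have := pt_t1l H
  | H : pt_t _ (pt1 P) _ _ |- _ => have := pt_t1m H
  | H : pt_t _ _ ?x _, H' : pt_t _ _ ?x _ |- _ => have := pt_fun H H'
  | H : pt_t _ _ _ _, H' : pt_t _ _ _ _ |- _ => have := pt_inj H H'
  end; intuition congruence.

Lemma rstep_fun u v w z z' :
  pt0 P <> pt1 P -> rstep u v w z -> rstep u v w z' -> z = z'.
Proof.
move=> n01 s1 s2; case: s1; case: s2; intros; rstep_solve.
Qed.

Lemma rstep_inj u v w w' z :
  pt0 P <> pt1 P -> rstep u v w z -> rstep u v w' z -> w = w'.
Proof.
move=> n01 s1 s2; case: s1; case: s2; intros; rstep_solve.
Qed.

(** The relation [t(u, v, w) = z] on reduced terms. Read as a function of [w] it defines [t], read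
    as a function of [z] it defines [q], so the two cancellation laws hold by construction and no
    confluence argument arises. *)
Variant reval u v w z : Prop :=
  | RevalStep of rstep u v w z
  | RevalT of z = Ternt u v w & reduced z
  | RevalQ of w = Ternq u v z & reduced w.

Lemma rstep_reduced u v w z : reduced u -> reduced v -> rstep u v w z ->
  reduced w <-> reduced z.
Proof.
move=> ru rv [_ ->|_ ->|_ -> ->|_ -> ->|a b c d _ _ -> -> /pt_dom_t[dc dd]] //.
- by split=> // _; exact: pt_dom0.
- by split=> // _; exact: pt_dom0.
Qed.

(** Only the clauses for [0] accept a compound [w], and they would apply to [z] as well, making
    [q(u, v, z)] a redex. *)
Lemma rstepQ u v z w : reduced (Ternq u v z) -> ~ rstep u v (Ternq u v z) w.
Proof.
case=> _ _ _ nz _ s; case: s nz => // [uO _|vO _] [].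
  by exists z; exact: Rstep0l.
by exists z; exact: Rstep0m.
Qed.

Lemma rstepT u v z w : reduced (Ternt u v w) -> ~ rstep u v z (Ternt u v w).
Proof.
(* The clauses for [1] would make [t(u, v, w)] equal to its own subterm [v] or [u]. *)
have neq1 (a b c : term P) : Ternt a b c <> a.
  by elim: a b c => // a IHa b _ c _ b' c' [/IHa].
have neq2 (b a c : term P) : Ternt a b c <> b.
  by elim: b a c => // a _ b IHb c _ a' c' [_ /IHb].
case=> _ _ _ nw _ s; case: s nw => // [uO _|vO _|_ _ /neq2|_ _ /neq1] // [].
  by exists w; exact: Rstep0l.
by exists w; exact: Rstep0m.
Qed.

Lemma reval_fun u v w z z' : reduced w -> reduced z -> reduced z' ->
  reval u v w z -> reval u v w z' -> z = z'.
Proof.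
have [e01 _ rz rz' _ _|n01 _ _ _] := pselect (pt0 P = pt1 P).
  by rewrite (reduced_triv e01 rz) (reduced_triv e01 rz').
case=> [s|-> r|-> r]; case=> [s'|-> r'|e' r'] //.
- exact: rstep_fun s s'.
- by case: r' => _ _ _ []; exists z.
- by rewrite e' in s r'; case: (rstepQ r' s).
- by case: r => _ _ _ []; exists z'.
- by case: r => _ _ _ _ []; exists z'.
- by case: (rstepQ r s').
- by case: r' => _ _ _ _ []; exists z.
- by case: e'.
Qed.

Lemma reval_inj u v w w' z : reduced w -> reduced w' -> reduced z ->
  reval u v w z -> reval u v w' z -> w = w'.
Proof.
have [e01 rw rw' _ _ _|n01 _ _ _] := pselect (pt0 P = pt1 P).
  by rewrite (reduced_triv e01 rw) (reduced_triv e01 rw').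
case=> [s|-> r|-> r]; case=> [s'|e' r'|-> r'] //.
- exact: rstep_inj s s'.
- by rewrite e' in s r'; case: (rstepT r' s).
- by case: r' => _ _ _ []; exists w.
- by case: (rstepT r s').
- by case: e'.
- by case: r' => _ _ _ _ []; exists w.
- by case: r => _ _ _ []; exists w'.
- by case: r => _ _ _ _ []; exists w'.
Qed.

Lemma reval_t u v w : reduced u -> reduced v -> reduced w ->
  exists z, reduced z /\ reval u v w z.
Proof.
move=> ru rv rw; have [[z s]|ns] := pselect (exists z, rstep u v w z).
  by exists z; split; [exact: (rstep_reduced ru rv s).1|exact: RevalStep].
have [[z e]|nq] := pselect (exists z, w = Ternq u v z).
  by exists z; split; [move: rw; rewrite e => -[]|exact: RevalQ].
by exists (Ternt u v w); split; [|apply: RevalT].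
Qed.

Lemma reval_q u v z : reduced u -> reduced v -> reduced z ->
  exists w, reduced w /\ reval u v w z.
Proof.
move=> ru rv rz; have [[w s]|ns] := pselect (exists w, rstep u v w z).
  by exists w; split; [exact: (rstep_reduced ru rv s).2|exact: RevalStep].
have [[w e]|nt] := pselect (exists w, z = Ternt u v w).
  by exists w; split; [move: rz; rewrite e => -[]|exact: RevalT].
by exists (Ternq u v z); split; [|apply: RevalQ].
Qed.

Definition free_tern : Type := {s : term P | reduced s}.

Definition nform (x : free_tern) : term P := sval x.

Lemma nform_inj : injective nform.
Proof. by move=> [x ex] [y ey] /= E; exact: eq_exist. Qed.

Lemma nform_reduced x : reduced (nform x).
Proof. exact: svalP x. Qed.

Fact free_t_ex (x y z : free_tern) :
  exists w : free_tern, reval (nform x) (nform y) (nform z) (nform w).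
Proof.
have [w [rw e]] := reval_t (nform_reduced x) (nform_reduced y) (nform_reduced z).
by exists (exist _ w rw).
Qed.

Fact free_q_ex (x y z : free_tern) :
  exists w : free_tern, reval (nform x) (nform y) (nform w) (nform z).
Proof.
have [w [rw e]] := reval_q (nform_reduced x) (nform_reduced y) (nform_reduced z).
by exists (exist _ w rw).
Qed.

Definition free_t (x y z : free_tern) : free_tern := sval (cid (free_t_ex x y z)).
Definition free_q (x y z : free_tern) : free_tern := sval (cid (free_q_ex x y z)).
Definition free_var a (da : pt_dom a) : free_tern := exist _ (TVar a) da.
Definition free_0 : free_tern := free_var (pt_dom0 P).
Definition free_1 : free_tern := free_var (pt_dom1 P).

Fact free_tE (x y z w : free_tern) :
  reval (nform x) (nform y) (nform z) (nform w) <-> free_t x y z = w.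
Proof.
split=> [e|<-]; last exact: svalP (cid (free_t_ex x y z)).
apply: nform_inj; apply: reval_fun e; try exact: nform_reduced.
exact: svalP (cid (free_t_ex x y z)).
Qed.

Fact free_qE (x y z w : free_tern) :
  reval (nform x) (nform y) (nform w) (nform z) <-> free_q x y z = w.
Proof.
split=> [e|<-]; last exact: svalP (cid (free_q_ex x y z)).
apply: nform_inj; apply: reval_inj e; try exact: nform_reduced.
exact: svalP (cid (free_q_ex x y z)).
Qed.

Fact free_t0l x y : free_t free_0 x y = y.
Proof. by apply/free_tE/RevalStep/Rstep0l. Qed.
Fact free_t0m x y : free_t x free_0 y = y.
Proof. by apply/free_tE/RevalStep/Rstep0m. Qed.
Fact free_t1l x : free_t free_1 x free_0 = x.
Proof. by apply/free_tE/RevalStep/Rstep1l. Qed.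
Fact free_t1m x : free_t x free_1 free_0 = x.
Proof. by apply/free_tE/RevalStep/Rstep1m. Qed.
Fact free_tK (x y z : free_tern) : free_q x y (free_t x y z) = z.
Proof. by apply/free_qE/free_tE. Qed.
Fact free_qK (x y z : free_tern) : free_t x y (free_q x y z) = z.
Proof. by apply/free_tE/free_qE. Qed.

HB.instance Definition _ := isTernaryRing.Build free_tern
  free_t0l free_t0m free_t1l free_t1m free_tK free_qK.

Lemma free_ternt (x y z w : free_tern) :
  reval (nform x) (nform y) (nform z) (nform w) <-> ternt x y z = w.
Proof. exact: free_tE. Qed.

Lemma free_incl (X : ternaryRingType) (k : X -> P) :
  k tern0 = pt0 P -> k tern1 = pt1 P -> (forall x, pt_dom (k x)) ->
  (forall x y z : X, pt_t (k x) (k y) (k z) (k (ternt x y z))) ->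
  exists f : tern_hom X free_tern, forall x, nform (f x) = TVar (k x).
Proof.
move=> k0 k1 kdom kt; pose f x := free_var (kdom x).
have f0 : f tern0 = tern0 by apply: nform_inj; rewrite /= k0.
have f1 : f tern1 = tern1 by apply: nform_inj; rewrite /= k1.
have ft (x y z : X) : f (ternt x y z) = ternt (f x) (f y) (f z).
  by apply/esym/free_ternt/RevalStep; apply: RstepD (kt x y z).
by exists (mk_tern_hom f0 f1 ft).
Qed.

Lemma free_eval (W : ternaryRingType) (m : P -> W) :
  m (pt0 P) = tern0 -> m (pt1 P) = tern1 ->
  (forall a b c d, pt_t a b c d -> m d = ternt (m a) (m b) (m c)) ->
  exists f : tern_hom free_tern W, forall x, f x = teval m (nform x).
Proof.
move=> m0 m1 mt; pose f (x : free_tern) := teval m (nform x).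
have ft (x y z : free_tern) : f (ternt x y z) = ternt (f x) (f y) (f z).
  have /free_ternt := erefl (ternt x y z); rewrite /f.
  case=> [[-> ->|-> ->|-> -> ->|-> -> ->|a b c d -> -> -> -> /mt//]|-> _|-> _] //=.
  - by rewrite m0 ternt0l.
  - by rewrite m0 ternt0m.
  - by rewrite m0 m1 ternt1l.
  - by rewrite m0 m1 ternt1m.
  - by rewrite ternqK.
by exists (@mk_tern_hom free_tern W f m0 m1 ft).
Qed.

End ReducedTerms.

(** * Normal forms under embeddings of partial ternary rings *)

Fixpoint term_map (V W : Type) (m : V -> W) (s : term V) : term W :=
  match s with
  | TVar x => TVar (m x)
  | Tern0 => Tern0 W
  | Tern1 => Tern1 W
  | Ternt u v w => Ternt (term_map m u) (term_map m v) (term_map m w)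
  | Ternq u v w => Ternq (term_map m u) (term_map m v) (term_map m w)
  end.

Section FreeMap.
Variables (P Q : partial_tern) (m : P -> Q).
Hypotheses (m0 : m (pt0 P) = pt0 Q) (m1 : m (pt1 P) = pt1 Q).
Hypothesis mdom : forall a, pt_dom a -> pt_dom (m a).
Hypothesis minj : forall a b, pt_dom a -> pt_dom b -> m a = m b -> a = b.
Hypothesis mt : forall a b c d, pt_t a b c d -> pt_t (m a) (m b) (m c) (m d).
Hypothesis mt_lift : forall a b c d', pt_dom a -> pt_dom b -> pt_dom c ->
  pt_t (m a) (m b) (m c) d' -> exists d, pt_t a b c d.
Hypothesis mq_lift : forall a b c' d, pt_dom a -> pt_dom b -> pt_dom d ->
  pt_t (m a) (m b) c' (m d) -> exists c, pt_t a b c d.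

Lemma term_map_inj s s' :
  reduced s -> reduced s' -> term_map m s = term_map m s' -> s = s'.
Proof.
elim: s s' => [a|//|//|u IHu v IHv w IHw|u IHu v IHv w IHw].
- by case=> //= b da db [/minj->].
- case=> //= u' v' w' [ru rv rw _ _] [ru' rv' rw' _ _] [eu ev ew].
  by rewrite (IHu _ ru ru' eu) (IHv _ rv rv' ev) (IHw _ rw rw' ew).
- case=> //= u' v' w' [ru rv rw _ _] [ru' rv' rw' _ _] [eu ev ew].
  by rewrite (IHu _ ru ru' eu) (IHv _ rv rv' ev) (IHw _ rw rw' ew).
Qed.

Let term_map_var s a : term_map m s = TVar a -> exists2 b, s = TVar b & m b = a.
Proof. by case: s => //= b [<-]; exists b. Qed.

Lemma rstep_map u v w z :
  rstep u v w z -> rstep (term_map m u) (term_map m v) (term_map m w) (term_map m z).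
Proof.
case=> [-> ->|-> ->|-> -> ->|-> -> ->|a b c d -> -> -> -> /mt D] /=.
- by apply: Rstep0l => //=; rewrite m0.
- by apply: Rstep0m => //=; rewrite m0.
- by apply: Rstep1l => //=; rewrite (m0, m1).
- by apply: Rstep1m => //=; rewrite (m0, m1).
- exact: RstepD D.
Qed.

Let map_const s a : reduced s -> pt_dom a -> term_map m s = TVar (m a) -> s = TVar a.
Proof. by move=> rs da /(@term_map_inj _ (TVar a)); exact. Qed.

Let map0 s : reduced s -> term_map m s = TVar (pt0 Q) -> s = TVar (pt0 P).
Proof. by rewrite -m0; move=> /map_const; apply; exact: pt_dom0. Qed.

Let map1 s : reduced s -> term_map m s = TVar (pt1 Q) -> s = TVar (pt1 P).
Proof. by rewrite -m1; move=> /map_const; apply; exact: pt_dom1. Qed.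

Lemma rstep_map_t u v w z' : reduced u -> reduced v -> reduced w ->
  rstep (term_map m u) (term_map m v) (term_map m w) z' ->
  exists z, rstep u v w z.
Proof.
move=> ru rv rw; case=> [eu _|ev _|eu ew _|ev ew _|a b c d].
- by exists w; apply: Rstep0l => //; exact: map0.
- by exists w; apply: Rstep0m => //; exact: map0.
- by exists v; apply: Rstep1l => //; [exact: map1|exact: map0].
- by exists u; apply: Rstep1m => //; [exact: map1|exact: map0].
- move=> /term_map_var[a' ua <-] /term_map_var[b' vb <-].
  move=> /term_map_var[c' wc <-] _.
  move: ru rv rw; rewrite ua vb wc => /= ra rb rc /(mt_lift ra rb rc)[d' D].
  by exists (TVar d'); exact: RstepD D.
Qed.

Lemma rstep_map_q u v w' z : reduced u -> reduced v -> reduced z ->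
  rstep (term_map m u) (term_map m v) w' (term_map m z) ->
  exists w, rstep u v w z.
Proof.
move=> ru rv rz; case=> [eu _|ev _|eu ew ez|ev ew ez|a b c d].
- by exists z; apply: Rstep0l => //; exact: map0.
- by exists z; apply: Rstep0m => //; exact: map0.
- exists (TVar (pt0 P)); apply: Rstep1l => //; first exact: map1.
  exact: term_map_inj.
- exists (TVar (pt0 P)); apply: Rstep1m => //; first exact: map1.
  exact: term_map_inj.
- move=> /term_map_var[a' ua <-] /term_map_var[b' vb <-] _.
  move=> /term_map_var[d' zd <-].
  move: ru rv rz; rewrite ua vb zd => /= ra rb rd /(mq_lift ra rb rd)[c' D].
  by exists (TVar c'); exact: RstepD D.
Qed.

(** [m] creates no redex: [mt_lift] and [mq_lift] reflect definedness, and injectivity on reduced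
    terms reflects the constants and the cancellations. *)
Lemma reduced_map s : reduced s -> reduced (term_map m s).
Proof.
elim: s => //= u IHu v IHv w IHw.
- case=> ru rv rw ns nq; split; [exact: IHu|exact: IHv|exact: IHw| |].
    by case=> z /(rstep_map_t ru rv rw).
  case=> z; case: w rw nq {IHw ns} => //= u' v' w' [ru' rv' _ _ _] nq.
  case=> /(term_map_inj ru' ru) eu /(term_map_inj rv' rv) ev _.
  by apply: nq; exists w'; rewrite eu ev.
- case=> ru rv rw ns nq; split; [exact: IHu|exact: IHv|exact: IHw| |].
    by case=> z /(rstep_map_q ru rv rw).
  case=> z; case: w rw nq {IHw ns} => //= u' v' w' [ru' rv' _ _ _] nq.
  case=> /(term_map_inj ru' ru) eu /(term_map_inj rv' rv) ev _.
  by apply: nq; exists w'; rewrite eu ev.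
Qed.

Lemma free_map : exists f : tern_hom (free_tern P) (free_tern Q),
  forall x, nform (f x) = term_map m (nform x).
Proof.
pose f (x : free_tern P) : free_tern Q :=
  exist _ (term_map m (nform x)) (reduced_map (nform_reduced x)).
have f0 : f tern0 = tern0 by apply: nform_inj; rewrite /= m0.
have f1 : f tern1 = tern1 by apply: nform_inj; rewrite /= m1.
have ft x y z : f (ternt x y z) = ternt (f x) (f y) (f z).
  apply/esym/free_ternt => /=.
  have /free_ternt := erefl (ternt x y z); case=> [s|e r|e r].
  - exact/RevalStep/rstep_map.
  - by apply: RevalT; [rewrite e|exact: reduced_map].
  - by apply: RevalQ; [rewrite e|exact: reduced_map].
by exists (mk_tern_hom f0 f1 ft).
Qed.

End FreeMap.

(** * Normal forms in pushouts *)

Section KernelCongruence.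
Variables (X : ternaryRingType) (U : Type) (k : X -> U).
Hypothesis ck : congruence (fun x y => k x = k y).

(** This and the next four facts are laws of the quotient of [X] by the kernel of [k], stated on
    representatives. They supply the axioms of the glued partial structure. *)
Lemma ker_t0l x y z : k x = k tern0 -> k (ternt x y z) = k z.
Proof. by move=> e; rewrite -[in RHS](ternt0l y z); exact: (cong_t ck). Qed.

Lemma ker_t0m x y z : k y = k tern0 -> k (ternt x y z) = k z.
Proof. by move=> e; rewrite -[in RHS](ternt0m x z); exact: (cong_t ck). Qed.

Lemma ker_t1l x y z : k x = k tern1 -> k z = k tern0 <-> k (ternt x y z) = k y.
Proof.
move=> e; split=> [ez|et]; first by rewrite -[in RHS](ternt1l y); exact: (cong_t ck).
rewrite -(ternq1l y) -[in LHS](terntK x y z); exact: (cong_q ck).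
Qed.

Lemma ker_t1m x y z : k y = k tern1 -> k z = k tern0 <-> k (ternt x y z) = k x.
Proof.
move=> e; split=> [ez|et]; first by rewrite -[in RHS](ternt1m x); exact: (cong_t ck).
rewrite -(ternqm1 x) -[in LHS](terntK x y z); exact: (cong_q ck).
Qed.

Lemma ker_triv x : k tern0 = k tern1 -> k x = k tern0.
Proof.
move=> e; rewrite -(ternt1l x) -[in RHS](ternt0l x tern0).
exact: (cong_t ck).
Qed.

End KernelCongruence.

Section Gluing.
Variables (R X Y : ternaryRingType) (h : tern_hom R X) (g : tern_hom R Y).
Variables (U : Type) (i : X -> U) (j : Y -> U).

(** Covers two cases: a set-level amalgam, where [i] and [j] are injective, and the images of [X]
    and [S] in their pushout, where [j] may have a nontrivial kernel. *)
Record gluing : Prop := Gluing {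
  glue_kerl : congruence (fun x x' => i x = i x');
  glue_kerr : congruence (fun y y' => j y = j y');
  glue_sq : forall r, i (h r) = j (g r);
  glue_meet : forall x y, i x = j y -> exists r, i x = i (h r) }.

Variant glue_t (a b c d : U) : Prop :=
  | GlueL x y z of a = i x & b = i y & c = i z & d = i (ternt x y z)
  | GlueR x y z of a = j x & b = j y & c = j z & d = j (ternt x y z).

Definition glue_dom : set U := range i `|` range j.

Hypothesis G : gluing.

Let cl := glue_kerl G.
Let cr := glue_kerr G.

Let j0 : j tern0 = i tern0.
Proof. by rewrite -(tern_hom0 g) -glue_sq // tern_hom0. Qed.

Let j1 : j tern1 = i tern1.
Proof. by rewrite -(tern_hom1 g) -glue_sq // tern_hom1. Qed.

Let meet x y : i x = j y -> exists r, i x = i (h r) /\ j y = j (g r).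
Proof.
by move=> e; case: (glue_meet G e) => r er; exists r; rewrite -glue_sq // -e.
Qed.

(** Arguments in both images come from [R], so both structures compute the image of one operation of
    [R]. *)
Let meet_t x x' y y' z z' : i x = j x' -> i y = j y' -> i z = j z' ->
  i (ternt x y z) = j (ternt x' y' z').
Proof.
move=> /meet[r [ex ex']] /meet[s [ey ey']] /meet[t [ez ez']].
by rewrite (cong_t cl ex ey ez) (cong_t cr ex' ey' ez') -!tern_homt glue_sq.
Qed.

Let meet_q x x' y y' z z' : i x = j x' -> i y = j y' -> i z = j z' ->
  i (ternq x y z) = j (ternq x' y' z').
Proof.
move=> /meet[r [ex ex']] /meet[s [ey ey']] /meet[t [ez ez']].
by rewrite (cong_q cl ex ey ez) (cong_q cr ex' ey' ez') -!tern_homq glue_sq.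
Qed.

Fact glue_dom_t a b c d : glue_t a b c d -> glue_dom c /\ glue_dom d.
Proof.
by case=> x y z _ _ -> ->; split; [left|left|right|right];
  [exists z|exists (ternt x y z)|exists z|exists (ternt x y z)].
Qed.

Fact glue_fun a b c d d' : glue_t a b c d -> glue_t a b c d' -> d = d'.
Proof.
case=> x y z -> -> -> ->; case=> x' y' z' ex ey ez ->.
- exact: (cong_t cl).
- exact: meet_t.
- by apply/esym/meet_t.
- exact: (cong_t cr).
Qed.

Fact glue_inj a b c c' d : glue_t a b c d -> glue_t a b c' d -> c = c'.
Proof.
case=> x y z -> -> -> ->; case=> x' y' z' ex ey -> et;
  rewrite -(terntK x y z) -(terntK x' y' z').
- exact: (cong_q cl).
- exact: meet_q.
- by apply/esym/meet_q.
- exact: (cong_q cr).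
Qed.

Fact glue_t0l b c d : glue_t (i tern0) b c d -> d = c.
Proof.
case=> x y z e _ -> ->; first exact: (ker_t0l cl).
by apply: (ker_t0l cr); rewrite j0.
Qed.

Fact glue_t0m a c d : glue_t a (i tern0) c d -> d = c.
Proof.
case=> x y z _ e -> ->; first exact: (ker_t0m cl).
by apply: (ker_t0m cr); rewrite j0.
Qed.

Fact glue_t1l b c d : glue_t (i tern1) b c d -> (c = i tern0 <-> d = b).
Proof.
case=> x y z e -> -> ->; first exact: (ker_t1l cl).
by rewrite -j0; apply: (ker_t1l cr); rewrite j1.
Qed.

Fact glue_t1m a c d : glue_t a (i tern1) c d -> (c = i tern0 <-> d = a).
Proof.
case=> x y z -> e -> ->; first exact: (ker_t1m cl).
by rewrite -j0; apply: (ker_t1m cr); rewrite j1.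
Qed.

Fact glue_triv : i tern0 = i tern1 -> forall a, glue_dom a -> a = i tern0.
Proof.
move=> e a [[x _ <-]|[y _ <-]]; first exact: (ker_triv cl).
by rewrite -j0; apply: (ker_triv cr); rewrite j0 j1.
Qed.

Definition glue : partial_tern := PartialTern
  (or_introl (ex_intro2 _ _ tern0 Logic.I erefl) : glue_dom (i tern0))
  (or_introl (ex_intro2 _ _ tern1 Logic.I erefl) : glue_dom (i tern1))
  glue_dom_t glue_fun glue_inj glue_t0l glue_t0m glue_t1l glue_t1m glue_triv.

Lemma free_glue :
  exists (u : tern_hom X (free_tern glue)) (v : tern_hom Y (free_tern glue)),
    (forall x, nform (u x) = TVar (i x : glue)) /\
    (forall y, nform (v y) = TVar (j y : glue)).
Proof.
have [||x||u Hu] := @free_incl glue X i => //; first by left; exists x.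
  by move=> x y z; exact: GlueL.
have [||x||v Hv] := @free_incl glue Y j => //; first by right; exists x.
  by move=> x y z; exact: GlueR.
by exists u, v.
Qed.

End Gluing.

(** Equal kernels give [X] and [Y] a common image of [R] to be glued along. In the free ternary ring
    on the glued structure distinct elements stay distinct leaves. *)
Lemma strong_amalgamation (R X Y : ternaryRingType)
    (h : tern_hom R X) (g : tern_hom R Y) :
  (forall r s, h r = h s <-> g r = g s) ->
  exists (Z : ternaryRingType) (u : tern_hom X Z) (v : tern_hom Y Z),
  [/\ injective u, injective v, forall r, u (h r) = v (g r)
    & forall x y, u x = v y -> exists r, x = h r /\ y = g r].
Proof.
move=> hg.
(* Glue inside [X + Y] by redirecting [g R] into [X]; the elements [inr (g r)]
   are junk. *)
pose j y : X + Y :=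
  if pselect (exists r, g r = y) is left e then inl (h (sval (cid e))) else inr y.
have jg r : j (g r) = inl (h r).
  rewrite /j; case: pselect => [e|[]]; last by exists r.
  by congr inl; apply/hg; exact: svalP (cid e).
have meet x y : inl x = j y -> exists r, x = h r /\ y = g r.
  rewrite {1}/j; case: pselect => // e [->].
  by exists (sval (cid e)); split=> //; rewrite (svalP (cid e)).
have jI : injective j.
  move=> y y'; have [[r <-]|ny] := pselect (exists r, g r = y).
    by rewrite jg => /meet[s [/hg -> ->]].
  rewrite {1}/j; case: pselect => // _; rewrite /j; by case: pselect => // _ [].
have G : gluing h g (@inl X Y) j.
  split=> [||r|x y /meet[r [-> _]]]; last by exists r.
  - split=> [//|x y -> //|x y z -> //||] x x' y y' z z' [->] [->] [->] //.
  - split=> [//|x y -> //|x y z -> //||] x x' y y' z z' /jI-> /jI-> /jI-> //.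
  - by rewrite jg.
have [u [v [Hu Hv]]] := free_glue G.
exists (free_tern (glue G)), u, v; split.
- by move=> x x' /(congr1 (@nform _)); rewrite !Hu => -[].
- by move=> y y' /(congr1 (@nform _)); rewrite !Hv => -[/jI].
- by move=> r; apply: nform_inj; rewrite Hu Hv jg.
- by move=> x y /(congr1 (@nform _)); rewrite Hu Hv => -[/meet].
Qed.

Section Pushout.
Variables (R X S : ternaryRingType) (h : tern_hom R X) (p : tern_hom R S).

Lemma po_sq r : tern_inl h p (h r) = tern_inr h p (p r).
Proof. exact: tern_hom_ext (tern_square h p) r. Qed.

Lemma po_desc_ex (Z : ternaryRingType) (u : tern_hom X Z) (v : tern_hom S Z) :
  (forall r, u (h r) = v (p r)) ->
  exists f : tern_hom (tern_po h p) Z,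
    (forall x, f (tern_inl h p x) = u x) /\ (forall s, f (tern_inr h p s) = v s).
Proof.
move=> uv; have e : tern_cmp u h = tern_cmp v p by exact: tern_hom_eq.
exists (tern_desc e); split.
  exact: tern_hom_ext (tern_descl e).
exact: tern_hom_ext (tern_descr e).
Qed.

Lemma po_hom_ext (Z : ternaryRingType) (f g : tern_hom (tern_po h p) Z) :
  (forall x, f (tern_inl h p x) = g (tern_inl h p x)) ->
  (forall s, f (tern_inr h p s) = g (tern_inr h p s)) ->
  forall w, f w = g w.
Proof.
move=> fgl fgr; apply: tern_hom_ext; apply: tern_uniq; exact: tern_hom_eq.
Qed.

(** By [thE], [R] has the same kernel in [X] and in [S / th], so these two amalgamate strongly. The
    pushout maps to that amalgam, which therefore bounds all identifications made in the pushout. *)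
Lemma po_amalgam (th : S -> S -> Prop) : congruence th ->
  (forall r s, th (p r) (p s) <-> h r = h s) ->
  [/\ injective (tern_inl h p),
      forall x s, tern_inl h p x = tern_inr h p s -> exists r, x = h r
    & forall s s', tern_inr h p s = tern_inr h p s' -> th s s'].
Proof.
move=> cth thE; have [Q [q [_ qE]]] := quotient_exists cth.
have [r s|Z [u [v [uI vI uv meet]]]] := @strong_amalgamation _ _ _ h (tern_cmp q p).
  by rewrite -thE -qE.
have [f [fl fr]] := @po_desc_ex Z u (tern_cmp v q) uv.
split=> [x y e|x s e|s s' e]; move/(congr1 f): e; rewrite !(fl, fr).
- exact: uI.
- by case/meet=> r [-> _]; exists r.
- by move/vI/qE.
Qed.

End Pushout.

(** * Pushouts along a homomorphism with the congruence extension property *)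

Section CongruenceExtension.
Variables (R S : ternaryRingType) (p : tern_hom R S).
Hypothesis cep : congruence_extension p.

Lemma po_inl_inj (X : ternaryRingType) (h : tern_hom R X) :
  injective (tern_inl h p).
Proof.
have [th [cth thE]] := cep (congruence_tern_ker h).
by case: (po_amalgam cth thE).
Qed.

Lemma po_meet (X : ternaryRingType) (h : tern_hom R X) x s :
  tern_inl h p x = tern_inr h p s -> exists r, x = h r.
Proof.
have [th [cth thE]] := cep (congruence_tern_ker h).
by case: (po_amalgam cth thE) => _ meet _ /meet.
Qed.

Lemma po_gluing (X : ternaryRingType) (h : tern_hom R X) :
  gluing h p (tern_inl h p) (tern_inr h p).
Proof.
split=> [||r|x s e].
- exact: (congruence_tern_ker (tern_inl h p)).
- exact: (congruence_tern_ker (tern_inr h p)).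
- exact: po_sq.
- by have [r ->] := po_meet e; exists r.
Qed.

Local Notation Pt h := (glue (po_gluing h)).

Lemma po_nform_ex (X : ternaryRingType) (h : tern_hom R X) :
  exists f : tern_hom (tern_po h p) (free_tern (Pt h)),
    (forall x, nform (f (tern_inl h p x)) = TVar (tern_inl h p x : Pt h)) /\
    (forall s, nform (f (tern_inr h p s)) = TVar (tern_inr h p s : Pt h)).
Proof.
have [u [v [Hu Hv]]] := free_glue (po_gluing h).
have [r|f [fl fr]] := @po_desc_ex _ _ _ h p _ u v.
  by apply: nform_inj; rewrite Hu Hv po_sq.
by exists f; split=> ?; rewrite (fl, fr).
Qed.

(** The leaves are kept as elements of the pushout itself, so evaluation at [id] recovers [w]. *)
Definition po_nform (X : ternaryRingType) (h : tern_hom R X)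
    (w : tern_po h p) : term (tern_po h p) :=
  nform (sval (cid (po_nform_ex h)) w).

Section NormalForm.
Variables (X : ternaryRingType) (h : tern_hom R X).

Lemma po_nform_reduced (w : tern_po h p) : @reduced (Pt h) (po_nform w).
Proof. exact: nform_reduced. Qed.

Lemma po_nforml x : po_nform (tern_inl h p x) = TVar (tern_inl h p x).
Proof. exact: (svalP (cid (po_nform_ex h))).1. Qed.

Lemma po_nformr s : po_nform (tern_inr h p s) = TVar (tern_inr h p s).
Proof. exact: (svalP (cid (po_nform_ex h))).2. Qed.

Lemma po_nformK (w : tern_po h p) : teval id (po_nform w) = w.
Proof.
have [|||e He] := @free_eval (Pt h) (tern_po h p) id.
- exact: (tern_hom0 (tern_inl h p)).
- exact: (tern_hom1 (tern_inl h p)).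
- by move=> a b c d [] x y z -> -> -> ->; rewrite tern_homt.
rewrite /po_nform -He; set f := sval _.
apply: (@po_hom_ext _ _ _ h p _ (tern_cmp e f) (tern_id _)) => /= x.
  by rewrite He [nform _]po_nforml.
by rewrite He [nform _]po_nformr.
Qed.

End NormalForm.

Section PushforwardMono.
Variables (X X' : ternaryRingType) (h : tern_hom R X) (h' : tern_hom R X').
Variables (f : tern_hom X X') (m : tern_hom (tern_po h p) (tern_po h' p)).
Hypotheses (fI : injective f) (fh : forall r, f (h r) = h' r).
Hypothesis ml : forall x, m (tern_inl h p x) = tern_inl h' p (f x).
Hypothesis mr : forall s, m (tern_inr h p s) = tern_inr h' p s.

(** The kernel of [S -> X + S] restricts on [R] to the kernel of [h], as [X -> X + S] is injective,
    and this is the kernel of [h'], as [f] is injective. Hence [po_amalgam] applies to [h'] with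
    this congruence. *)
Lemma po_inr_ker s s' :
  tern_inr h' p s = tern_inr h' p s' -> tern_inr h p s = tern_inr h p s'.
Proof.
have cth := congruence_tern_ker (tern_inr h p).
have [r r'|_ _ H] := @po_amalgam _ _ _ h' p _ cth; last exact: H.
rewrite /tern_ker -!po_sq -!fh; split=> [/po_inl_inj -> //|/fI -> //].
Qed.

Let dom : set (tern_po h p) := @pt_dom (Pt h).

(** Together with [map_range_r], this makes [m] reflect definedness, as [mt_lift] and [mq_lift]
    demand. *)
Let map_range_l a x' : dom a -> m a = tern_inl h' p x' ->
  exists x, a = tern_inl h p x.
Proof.
case=> [[x _ <-]|[s _ <-]]; first by exists x.
rewrite mr => /esym e; have [r xE] := po_meet e; move: e.
rewrite xE po_sq => /po_inr_ker e.
by exists (h r); rewrite po_sq.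
Qed.

Let map_range_r a s' : dom a -> m a = tern_inr h' p s' ->
  exists s, a = tern_inr h p s.
Proof.
case=> [[x _ <-]|[s _ <-]]; last by exists s.
rewrite ml => e; have [r] := po_meet e; rewrite -fh => /fI ->.
by exists (p r); rewrite po_sq.
Qed.

Let map_inj a b : dom a -> dom b -> m a = m b -> a = b.
Proof.
have lr x s : m (tern_inl h p x) = m (tern_inr h p s) ->
    tern_inl h p x = tern_inr h p s.
  rewrite ml mr => e; have [r] := po_meet e; rewrite -fh => /fI xE.
  by move: e; rewrite xE fh !po_sq => /po_inr_ker.
case=> [[x _ <-]|[s _ <-]]; case=> [[x' _ <-]|[s' _ <-]].
- by rewrite !ml => /po_inl_inj/fI ->.
- exact: lr.
- by move/esym/lr.
- by rewrite !mr => /po_inr_ker.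
Qed.

Lemma po_nform_map w : po_nform (m w) = term_map m (po_nform w).
Proof.
have [||||||| F HF] := @free_map (Pt h) (Pt h') m.
- by rewrite /= ml tern_hom0.
- by rewrite /= ml tern_hom1.
- move=> a [[x _ <-]|[s _ <-]]; [left; exists (f x)|right; exists s] => //.
- exact: map_inj.
- move=> a b c d [] x y z -> -> -> ->.
    by apply: (@GlueL _ _ _ _ _ _ _ _ _ (f x) (f y) (f z)); rewrite ml ?tern_homt.
  by apply: (@GlueR _ _ _ _ _ _ _ _ _ x y z); rewrite mr.
- move=> a b c d' da db dc [] x y z ea eb ec _.
    have [x0 ->] := map_range_l da ea; have [y0 ->] := map_range_l db eb.
    have [z0 ->] := map_range_l dc ec.
    by exists (tern_inl h p (ternt x0 y0 z0)); exact: GlueL.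
  have [x0 ->] := map_range_r da ea; have [y0 ->] := map_range_r db eb.
  have [z0 ->] := map_range_r dc ec.
  by exists (tern_inr h p (ternt x0 y0 z0)); exact: GlueR.
- move=> a b c' d da db dd [] x y z ea eb _ ed.
    have [x0 ->] := map_range_l da ea; have [y0 ->] := map_range_l db eb.
    have [z0 ->] := map_range_l dd ed.
    exists (tern_inl h p (ternq x0 y0 z0)).
    by apply: GlueL => //; rewrite ternqK.
  have [x0 ->] := map_range_r da ea; have [y0 ->] := map_range_r db eb.
  have [z0 ->] := map_range_r dd ed.
  exists (tern_inr h p (ternq x0 y0 z0)).
  by apply: GlueR => //; rewrite ternqK.
rewrite /po_nform -HF; apply: (congr1 (@nform (Pt h'))).
set u := sval _; set v := sval _.
apply: (@po_hom_ext _ _ _ h p _ (tern_cmp u m) (tern_cmp F v)) => /= x.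
  by apply: nform_inj; rewrite HF ml [nform _]po_nforml [nform (v _)]po_nforml /= ml.
by apply: nform_inj; rewrite HF mr [nform _]po_nformr [nform (v _)]po_nformr /= mr.
Qed.

(** Pushing out along [p] preserves injectivity: [m] is injective on leaves, hence on normal
    forms. *)
Lemma po_map_inj : injective m.
Proof.
move=> w w' /(congr1 (po_nform (h := h'))); rewrite !po_nform_map => e.
rewrite -(po_nformK w) -(po_nformK w'); congr teval.
by apply: (@term_map_inj (Pt h) (Pt h') m map_inj) e; exact: po_nform_reduced.
Qed.

End PushforwardMono.
End CongruenceExtension.

(** * The comparison functor *)

(** Equality of the two relabelled terms is equality leaf by leaf, and the image of [k] is closed
    under the operations. *)
Lemma reduced_agree (P Q : partial_tern) (m m' : P -> Q)
    (V W : ternaryRingType) (k : tern_hom V W) (e : P -> W) (s : term P) :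
  (forall a, pt_dom a -> m a = m' a -> exists v, k v = e a) ->
  reduced s -> term_map m s = term_map m' s -> exists v, k v = teval e s.
Proof.
move=> leaf; elim: s => //= [a da [ma]|u IHu v IHv w IHw|u IHu v IHv w IHw].
- exact: leaf.
- case=> ru rv rw _ _ [/(IHu ru)[x <-] /(IHv rv)[y <-] /(IHw rw)[z <-]].
  by exists (ternt x y z); exact: tern_homt.
- case=> ru rv rw _ _ [/(IHu ru)[x <-] /(IHv rv)[y <-] /(IHw rw)[z <-]].
  by exists (ternq x y z); exact: tern_homq.
Qed.

Lemma tern_bij_iso (A B : ternaryRingType) (f : tern_hom A B) :
  injective f -> (forall b, exists a, f a = b) -> @is_iso TernaryRings A B f.
Proof.
move=> fI fS; have [g fg] := @tern_hom_factor B A B f (tern_id B) fI fS.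
exists g; split; apply: tern_hom_eq => x /=; last exact: fg.
by apply: fI; exact: fg.
Qed.

Section Codescent.
Variables (R S : ternaryRingType) (p : tern_hom R S).

Local Notation RC := (@coslice TernaryRings R).
Local Notation SC := (@coslice TernaryRings S).
Local Notation push := (@push_obj TernaryRings TernaryRings_pushouts R S p).
Local Notation pushm := (@push_mor TernaryRings TernaryRings_pushouts R S p _ _).
Local Notation adj := (@cobase_adjunction TernaryRings TernaryRings_pushouts R S p).
Local Notation pullb := (@precomp TernaryRings R S p).

Definition cs_hom (B : TernaryRings) (X : @coslice TernaryRings B) :
  tern_hom B (cs_cod X) := cs_arr X.

Definition cs_fun (B : TernaryRings) (X Y : @coslice TernaryRings B)
  (f : hom X Y) : tern_hom (cs_cod X) (cs_cod Y) := cs_mor f.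

Lemma cs_funP (B : TernaryRings) (X Y : @coslice TernaryRings B) (f : hom X Y) b :
  cs_fun f (cs_hom X b) = cs_hom Y b.
Proof. exact: tern_hom_ext (cs_morP f) b. Qed.

Lemma cs_fun_eq (B : TernaryRings) (X Y : @coslice TernaryRings B) (f g : hom X Y) :
  (forall x, cs_fun f x = cs_fun g x) -> f = g.
Proof. by move=> fg; apply: coslice_hom_eq; exact: tern_hom_eq. Qed.

Definition cs_mk (B : TernaryRings) (X Y : @coslice TernaryRings B)
    (f : tern_hom (cs_cod X) (cs_cod Y))
    (fP : forall b, f (cs_hom X b) = cs_hom Y b) : hom X Y :=
  @CosliceHom TernaryRings B X Y f
    (@tern_hom_eq _ _ (tern_cmp f (cs_hom X)) (cs_hom Y) fP).

Local Notation inl_ X := (tern_inl (cs_hom X) p).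
Local Notation inr_ X := (tern_inr (cs_hom X) p).

Lemma pushl (X Y : RC) (f : hom X Y) x :
  cs_fun (pushm f) (inl_ X x) = inl_ Y (cs_fun f x).
Proof. exact: tern_hom_ext (push_morl TernaryRings_pushouts p f) x. Qed.

Lemma pushr (X Y : RC) (f : hom X Y) s :
  cs_fun (pushm f) (inr_ X s) = inr_ Y s.
Proof. exact: tern_hom_ext (push_morr TernaryRings_pushouts p f) s. Qed.

Lemma push_hom_eq (X : RC) (Z : SC) (f g : hom (push X : SC) Z) :
  (forall x, cs_fun f (inl_ X x) = cs_fun g (inl_ X x)) -> f = g.
Proof.
move=> fg; apply: cs_fun_eq; apply: po_hom_ext => // s.
exact: etrans (cs_funP f s) (esym (cs_funP g s)).
Qed.

Lemma codescent_congruence_extension :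
  @codescent TernaryRings TernaryRings_pushouts R S p -> congruence_extension p.
Proof.
case=> _ faith th cth; have [Q [q [_ qE]]] := quotient_exists cth.
exists (tern_ker (tern_inr q p)); split; first exact: congruence_tern_ker.
move=> x y; rewrite /tern_ker -!po_sq -qE; split=> [|-> //].
move: (q x) (q y) => a b eab.
(* The equalizer of [l1] and [l2] is the kernel pair of [Q -> Q + S]. It contains the diagonal,
   hence is an object under [R] through [(q, q)]. *)
pose l1 := tern_cmp (tern_inl q p) (tern_fst Q Q).
pose l2 := tern_cmp (tern_inl q p) (tern_snd Q Q).
have [//|k kE] := @tern_eq_lift _ _ l1 l2 R (tern_pair q q).
pose X : RC := @CosliceObj TernaryRings R (tern_eq l1 l2) k.
pose Y : RC := @CosliceObj TernaryRings R Q q.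
pose f1 : hom X Y := @cs_mk _ X Y (tern_cmp (tern_fst Q Q) (tern_eq_incl l1 l2))
  (fun r => congr1 fst (kE r)).
pose f2 : hom X Y := @cs_mk _ X Y (tern_cmp (tern_snd Q Q) (tern_eq_incl l1 l2))
  (fun r => congr1 snd (kE r)).
(* After pushing out, the two projections agree on [X] by definition of the kernel pair, and on [S]
   as morphisms under [S]. *)
have f12 : f1 = f2.
  apply: faith; apply: coalgebra_hom_eq.
  apply: (@push_hom_eq X (push Y) (pushm f1) (pushm f2)) => z.
  by rewrite !pushl; exact: svalP z.
pose z : tern_eq l1 l2 := exist _ (a, b) eab.
exact: (congr1 (fun f : hom X Y => cs_fun f z) f12).
Qed.

Hypothesis cep : congruence_extension p.

Let K := comparison adj.

Lemma comparison_faithful : faithful K.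
Proof.
move=> X Y f g fg; apply: cs_fun_eq => x; apply: (po_inl_inj cep (h := cs_hom Y)).
rewrite -!pushl.
have e := congr1 (fun g : hom (K X) (K Y) =>
  cs_fun (coalg_mor g : hom (push X : SC) (push Y)) (inl_ X x)) fg.
exact: e.
Qed.

Let unit (X : RC) : hom X (pullb (push X)) := adj_unit adj X.
Let counit (X : SC) : hom (push (pullb X) : SC) X := adj_counit adj X.

Let unitE X x : cs_fun (unit X) x = inl_ X x.
Proof. by []. Qed.

Let counitl (X : SC) x : cs_fun (counit X) (inl_ (pullb X) x) = x.
Proof. exact: tern_hom_ext (cobase_counitl TernaryRings_pushouts p X) x. Qed.

Lemma comparison_full : full K.
Proof.
move=> X Y g; pose g0 : hom (push X : SC) (push Y) := coalg_mor g.
(* The coalgebra morphism equation at [inl x]: the values of [g0] there equalize the pushed-out unit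
   and the coprojection. *)
have gP x : cs_fun (pushm (unit Y)) (cs_fun g0 (inl_ X x)) =
    inl_ (pullb (push Y)) (cs_fun g0 (inl_ X x)).
  rewrite -[in RHS](unitE x) -(pushl (fmap pullb g0)) -pushl.
  have e := congr1 (fun f : hom (push X : SC) (push (pullb (push Y))) =>
    cs_fun f (inl_ X x)) (coalg_morP g).
  exact e.
have [x|f fE] := @tern_hom_factor _ _ _ (inl_ Y)
  (tern_cmp (cs_fun g0) (inl_ X)) (po_inl_inj cep (h := cs_hom Y)).
  suff [y ey] : exists y, inl_ Y y = cs_fun g0 (inl_ X x) by exists y.
  move: (gP x); move: (cs_fun g0 (inl_ X x)) => w wP.
  have uP r : cs_fun (unit Y) (cs_hom Y r) = cs_hom (pullb (push Y)) r.
    by rewrite unitE po_sq.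
  have uI : injective (cs_fun (unit Y)) := po_inl_inj cep (h := cs_hom Y).
  (* The normal form of [inl w] is a single leaf, so that of [w] is one too, and [w] lies in the
     image of [Y] or of [S]. In the second case [po_meet] brings [w] back to the image of [R]. *)
  have := po_nform_map cep uI uP (pushl (unit Y)) (pushr (unit Y)) w.
  rewrite wP po_nforml.
  have := po_nform_reduced cep w; have := po_nformK cep w.
  case: (po_nform cep w) => //= u uw; rewrite {}uw => -[[y _ <-]|[s _ sw]] _.
    by exists y.
  move/esym: wP; rewrite -sw pushr => /(po_meet cep)[r ->].
  by exists (cs_hom Y r); exact: po_sq.
have {}fE x : inl_ Y (f x) = cs_fun g0 (inl_ X x) := fE x.
have fP r : f (cs_hom X r) = cs_hom Y r.
  apply: (po_inl_inj cep (h := cs_hom Y)); rewrite fE !po_sq.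
  exact (cs_funP g0 (p r)).
exists (cs_mk fP); apply: coalgebra_hom_eq.
by apply: (@push_hom_eq X (push Y) (pushm (cs_mk fP)) g0) => x; rewrite pushl -fE.
Qed.

Lemma comparison_surj (Y : coalgebra_category (adj_comonad adj)) :
  exists X : RC, exists e : hom (K X) Y, is_iso e.
Proof.
case: Y => X str strC strA.
pose xi : tern_hom (cs_cod X) (tern_po (cs_hom (pullb X)) p) := cs_fun str.
have xiP s : xi (cs_hom X s) = inr_ (pullb X) s := cs_funP str s.
have xiK x : cs_fun (counit X) (xi x) = x.
  exact: (congr1 (fun f => cs_fun f x) strC).
have xiI : injective xi := can_inj xiK.
pose m1 := cs_fun (pushm (unit (pullb X))).
pose m2 := cs_fun (pushm (fmap pullb str)).
(* Coassociativity: [m1] is the comultiplication and [m2] is the comonad applied to [xi]. *)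
have xiA x : m1 (xi x) = m2 (xi x).
  exact: (congr1 (fun f => cs_fun f x) strA).
have hA r : xi (cs_hom (pullb X) r) = inl_ (pullb X) (cs_hom (pullb X) r).
  by rewrite po_sq; exact: xiP.
have uI : injective (cs_fun (unit (pullb X))) := po_inl_inj cep (h := _).
have uP r : cs_fun (unit (pullb X)) (cs_hom (pullb X) r) =
    cs_hom (pullb (push (pullb X))) r by rewrite unitE po_sq.
have hP r : xi (cs_hom (pullb X) r) = cs_hom (pullb (push (pullb X))) r.
  exact: xiP.
have [k kE] := tern_eq_lift hA.
pose A : RC := @CosliceObj TernaryRings R (tern_eq xi (inl_ (pullb X))) k.
pose i : hom A (pullb X) := @cs_mk _ A (pullb X) (tern_eq_incl _ _) kE.
pose mi := cs_fun (pushm i).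
pose g : hom (push A : SC) X := counit X ∘ pushm i.
have gl a : cs_fun g (inl_ A a) = cs_fun i a.
  change (cs_fun (counit X) (mi (inl_ A a)) = cs_fun i a).
  by rewrite /mi pushl counitl.
(* Checked on generators: [xi] is the coprojection on [A] by definition of the equalizer, and on [S]
   both sides are the coprojection from [S]. Injectivity of [g] then follows from that of [mi]. *)
have xig w : xi (cs_fun g w) = mi w.
  apply: (@po_hom_ext _ _ _ _ _ _ (tern_cmp xi (cs_fun g)) mi) => [a|s].
    change (xi (cs_fun g (inl_ A a)) = mi (inl_ A a)).
    by rewrite gl /mi pushl; exact: svalP a.
  change (xi (cs_fun g (cs_hom (push A) s)) = mi (inr_ A s)).
  by rewrite cs_funP xiP /mi pushr.
have iI : injective (cs_fun i) := @tern_eq_inj _ _ _ _.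
have miI : injective mi.
  by apply: (po_map_inj cep iI kE); [exact: pushl|exact: pushr].
have gI : injective (cs_fun g) by move=> w w' e; apply: miI; rewrite -!xig e.
have gS x : exists w, cs_fun g w = x.
  have [|||w wE] := @reduced_agree
    (glue (po_gluing cep (cs_hom (pullb X))))
    (glue (po_gluing cep (cs_hom (pullb (push (pullb X))))))
    m1 m2 _ _ mi id (po_nform cep (xi x)).
  - move=> a [[y _ <-]|[s _ <-]]; last by exists (inr_ A s); exact: pushr.
    (* At a leaf [inl y] the two maps give [inl (inl y)] and [inl (xi y)], so agreement there puts
       [y] in [A]. *)
    rewrite /m1 /m2 !pushl => /(po_inl_inj cep) yA.
    by exists (inl_ A (exist _ y (esym yA))); exact: pushl.
  - exact: po_nform_reduced.
  - rewrite -(po_nform_map cep uI uP (pushl (unit _)) (pushr (unit _))).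
    rewrite -(po_nform_map cep xiI hP (pushl (fmap pullb str)) (pushr (fmap pullb str))).
    by congr po_nform; exact: xiA.
  by exists w; apply: xiI; rewrite xig wE po_nformK.
have gP : str ∘ g = fmap (adj_comonad adj) g ∘ coalg_str (K A).
  apply: (@push_hom_eq A (push (pullb X)) (str ∘ g)
    (pushm (fmap pullb g) ∘ pushm (unit A))) => a.
  change (xi (cs_fun g (inl_ A a)) =
    cs_fun (pushm (fmap pullb g)) (cs_fun (pushm (unit A)) (inl_ A a))).
  rewrite !pushl xig /mi pushl.
  by congr (inl_ (pullb X) _); apply/esym/gl.
exists A, (@CoalgebraHom _ _ (K A) (Coalgebra strC strA) g gP).
apply: coalgebra_iso; apply: coslice_iso.
exact: (tern_bij_iso gI gS).
Qed.

Lemma congruence_extension_effective_codescent :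
  @effective_codescent TernaryRings TernaryRings_pushouts R S p.
Proof.
apply: fully_faithful_equivalence; first exact: comparison_full.
  exact: comparison_faithful.
exact: comparison_surj.
Qed.

End Codescent.

Theorem theorem3p6 (R S : ternaryRingType) (p : tern_hom R S)
  (p_mono : @is_mono TernaryRings R S p) :
  [<-> @effective_codescent TernaryRings TernaryRings_pushouts R S p;
       @codescent TernaryRings TernaryRings_pushouts R S p;
       congruence_extension p;
       zero_ideal_extension p;
       forall I : set R, zero_ideal I ->
         p @^-1` (\bigcup_i tau_iter (p @` I) i) = I].
Proof.
tfae.
- exact: equivalence_fully_faithful.
- exact: codescent_congruence_extension.
- exact: congruence_extension_ideal.
- exact: zero_ideal_extension_tau.
(* The cycle closes through the congruence extension property. *)
- by move/tau_congruence_extension/congruence_extension_effective_codescent.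
Qed.
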